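(* Let $p$ be an odd prime and let $\bar\alpha\in\mathbb Q_p^*/(\mathbb Q_p^* )^2$ be a class of even valuation with $-1\notin\bar\alpha$. For any $v\in\mathbf D_{\bar\alpha}$, there is a unique point $\pi_{\bar\alpha}(v)\in\mathcal T$ whose stabilizer in $\mathrm{PGL}(2,\mathbb Q_p)$ contains the stabilizer of $v$ in $\mathrm{PGL}(2,\mathbb Q_p)$. The projection $\pi_{\bar\alpha}:\mathbf D_{\bar\alpha}\to\mathcal T$ so defined is a quasi-isometry, covariant (i.e. equivariant) for the action of $\mathrm{PGL}(2,\mathbb Q_p)$. Moreover, $\pi_{\bar\alpha}$ induces a bijection between the set of long lines in $\mathbf D_{\bar\alpha}$ and the set of geodesics in $\mathcal T$.
   Context: Tree: $\mathcal T$ is the tree of $\mathrm{PSL}(2,\mathbb Q_p)$. Its vertices are the rank $2$ free $\mathbb Z_p$-submodules (lattices) of $\mathbb Q_p^2$ up to homothety, identified with $\mathrm{PGL}(2,\mathbb Q_p)/\mathrm{PGL}(2,\mathbb Z_p)$; two vertices are joined by an edge if they have representatives one of which has index $p$ in the other. It carries the path metric with edges of length $1$ and the natural action of $\mathrm{PGL}(2,\mathbb Q_p)$. Points of $\mathcal T$ are its vertices. Geodesics are bi-infinite; the geodesic with ends $[v_1]\ne[v_2]\in\mathbf P_1(\mathbb Q_p)$ consists of the classes of lattices $\mathbb Z_p\,xv_1\oplus\mathbb Z_p\,yv_2$, $x,y\in\mathbb Q_p^*$. Disc: put $\mathbf k=\mathbb Q_p$, $Q(x,y,z)=xz-y^2$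 on $\mathbf k^3$, $B(v,v')=\frac12[Q(v+v')-Q(v-v')]$. $K_{\bar\alpha}=\{\alpha x^2+y^2\in\mathbf k^*: x,y\in\mathbf k^*\}$ for any $\alpha\in\bar\alpha$ (an index $2$ subgroup of $\mathbf k^*$). $\mathbf S_{\bar\alpha}=(\mathbf k^3\setminus\{0\})/K_{\bar\alpha}$. $\mathcal C_{\bar1}=\{(a,b,c)\ne0: ac=b^2,\ a,c\text{ squares (possibly }0)\}$, $\mathcal C_{\bar\alpha}$ is its image in $\mathbf S_{\bar\alpha}$. $\mathcal H_{\bar\alpha}=\{v\in\mathbf k^3: B(v,w)\in K_{\bar\alpha}\ \forall w\in\mathcal C_{\bar1}\}$ and $\mathbf D_{\bar\alpha}$ is its image in $\mathbf S_{\bar\alpha}$. $g\in\mathrm{PGL}(2,\mathbf k)$ acts on $\mathbf D_{\bar\alpha}$ by $\det(g)\mathrm{Ad}(g)$, where, identifying $(x,y,z)$ with $S=\begin{pmatrix}x & y \\ y & z\end{pmatrix}$, $\mathrm{Ad}(g)S=\det(g)^{-1}gS\,{}^tg$. A long line in $\mathbf D_{\bar\alpha}$ is a non-empty intersection with $\mathbf D_{\bar\alpha}$ of the image in $\mathbf S_{\bar\alpha}$ of a linear plane of $\mathbf k^3$ to which $Q$ restricts as an isotropic form. The metric on $\mathbf D_{\bar\alpha}$ is the Hilbert distance: let $\mathbf D_{\bar\alpha}^\circ$ be the set of $\phi\in((\mathbf k^3)^*\setminus\{0\})/K_{\bar\alpha}$ with $\phi(x)\in K_{\bar\alpha}$ for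 all $x\in\mathbf D_{\bar\alpha}$; then $d_{\mathbf D_{\bar\alpha}}(x,y)$ is the Haar measure (on $\mathbb Q_p^*$, normalised by $\mu(\mathbb Z_p^* )=1$) of the smallest symmetric ball containing $\{\frac{\phi(y)}{\phi(x)}\frac{\phi'(x)}{\phi'(y)}:\phi,\phi'\in\mathbf D_{\bar\alpha}^\circ\}$, the symmetric ball of radius $r\ge 0$ being $\{t\in K_{\bar\alpha}:|t-1|\le r,\ |t^{-1}-1|\le r\}$. *)

(* Defs.v *)
From HB Require Import structures.
From mathcomp Require Import all_boot all_order all_algebra.
From mathcomp Require Import all_classical all_reals all_analysis.
Set Implicit Arguments.
Unset Strict Implicit.
Unset Printing Implicit Defensive.
Import Order.TTheory GRing.Theory Num.Theory.
Local Open Scope classical_set_scope.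
Local Open Scope ring_scope.

(* The field Q_p, presented (like the reals by realType) through the property
   that defines it up to unique isomorphism: it is the completion of Q for the
   p-adic absolute value.  padic_abs_nat gives |n| = p ^ (- v_p(n)), which by
   multiplicativity fixes the absolute value on Q. *)
Record padicField (R : realType) (p : nat) := PadicField {
  padic_carrier :> fieldType;
  padic_abs : padic_carrier -> R;
  padic_abs_ge0 : forall x, 0 <= padic_abs x;
  padic_abs_eq0 : forall x, padic_abs x = 0 -> x = 0;
  padic_absM : forall x y, padic_abs (x * y) = padic_abs x * padic_abs y;
  padic_absD : forall x y,
    padic_abs (x + y) <= Num.max (padic_abs x) (padic_abs y);
  padic_abs_nat : forall n : nat, (0 < n)%N ->
    padic_abs n%:R = p%:R ^- logn p n;
  padic_dense : forall (x : padic_carrier) (e : R), 0 < e ->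
    exists q : rat, padic_abs (x - ratr q) < e;
  padic_complete : forall u : nat -> padic_carrier,
    (forall e : R, 0 < e -> exists N, forall m n,
      (N <= m)%N -> (N <= n)%N -> padic_abs (u m - u n) < e) ->
    exists l, forall e : R, 0 < e -> exists N, forall n,
      (N <= n)%N -> padic_abs (u n - l) < e
}.

Section Scaling.
Variable F : fieldType.

Definition nonzero : set F := [set c | c != 0].

(* The class of v modulo multiplication by A; quotients such as
   (V \ {0}) / A are represented by the sets of such classes. *)
Definition scale_class (V : lmodType F) (A : set F) (v : V) : set V :=
  [set t *: v | t in A].

(* An element of PGL(2, F) is the set of all nonzero multiples of a matrix. *)
Definition PGL2 : set (set 'M[F]_2) :=
  [set G | exists2 g : 'M[F]_2, g \in unitmx & G = scale_class nonzero g].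

Definition stabilizer (X : Type) (act : set 'M[F]_2 -> X -> X) (x : X) :
  set (set 'M[F]_2) := [set G | PGL2 G /\ act G x = x].

End Scaling.

Section MultiplicativeGroup.
Variable F : fieldType.

Record kstar := KStar { kval :> F; kval_neq0 : kval != 0 }.

HB.instance Definition _ := [isSub for kval].
HB.instance Definition _ := [Choice of kstar by <:].
HB.instance Definition _ := isPointed.Build kstar (KStar (oner_neq0 F)).

Definition kstar_mul (a b : kstar) : kstar :=
  KStar (mulf_neq0 (kval_neq0 a) (kval_neq0 b)).

End MultiplicativeGroup.

Section Haar.
Variables (R : realType) (p : nat) (K : padicField R p).

Definition kstar_open : set (set (kstar K)) :=
  [set U | forall x, U x -> exists2 e : R, 0 < e &
     forall y : kstar K, padic_abs (kval y - kval x) < e -> U y].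

Definition kstar_borel := g_sigma_algebraType kstar_open.

(* Normalising on the compact open subgroup Z_p^* makes an invariant measure
   finite on compact sets and nonzero. *)
Definition is_normalized_haar (mu : set kstar_borel -> \bar R) : Prop :=
  (forall (a : kstar K) (A : set kstar_borel), measurable A ->
     mu [set kstar_mul a x | x in A] = mu A) /\
  mu [set x | padic_abs (kval x) = 1] = 1%E.

End Haar.

Section Tree.
Variables (R : realType) (p : nat) (K : padicField R p).
Local Notation vec := 'cV[K]_2.

Definition Zp : set K := [set x | padic_abs x <= 1].

Definition Zp_span (u w : vec) : set vec :=
  [set a *: u + b *: w | a in Zp & b in Zp].

Definition is_lattice (L : set vec) : Prop :=
  exists u w : vec,
    (forall a b, Zp a -> Zp b -> a *: u + b *: w = 0 -> a = 0 /\ b = 0) /\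
    L = Zp_span u w.

Definition homothety_class (L : set vec) : set (set vec) :=
  [set [set c *: v | v in L] | c in @nonzero K].

Definition tree : set (set (set vec)) :=
  [set X | exists2 L, is_lattice L & X = homothety_class L].

(* The cosets of M contained in L are in bijection with {0, ..., n - 1}. *)
Definition has_index (L M : set vec) (n : nat) : Prop :=
  M `<=` L /\ ([set [set x + m | m in M] | x in L] #= `I_n)%card.

Definition adjacent (X Y : set (set vec)) : Prop :=
  [/\ tree X, tree Y &
      exists L M, [/\ X L, Y M & has_index L M p \/ has_index M L p]].

Definition walk (X Y : set (set vec)) (n : nat) : Prop :=
  exists f : nat -> set (set vec),
    [/\ f 0%N = X, f n = Y & forall i, (i < n)%N -> adjacent (f i) (f i.+1)].

Definition tree_dist (X Y : set (set vec)) : \bar R :=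
  ereal_inf [set (n%:R)%:E | n in walk X Y].

(* If G is the class of g and X that of L, this is the class of g L. *)
Definition tree_act (G : set 'M[K]_2) (X : set (set vec)) : set (set vec) :=
  [set [set g *m v | v in L] | g in G & L in X].

Definition geodesic : set (set (set (set vec))) :=
  [set Gam | exists v1 v2 : vec,
     [/\ v1 != 0, v2 != 0, ~ (exists2 c : K, c != 0 & v2 = c *: v1) &
       Gam = [set homothety_class (Zp_span (x *: v1) (y *: v2)) |
                x in @nonzero K & y in @nonzero K]]].

End Tree.
Arguments tree {R p} K.
Arguments tree_dist {R p} K.
Arguments tree_act {R p} K.
Arguments geodesic {R p} K.

Section Disc.
Variables (R : realType) (p : nat) (K : padicField R p).
Local Notation vec := 'rV[K]_3.
Local Notation dual := 'Hom(vec, (K : fieldType)^o).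

Definition vec3 (x y z : K) : vec := \row_(i < 3) [:: x; y; z]`_i.
Definition xcoord (v : vec) : K := v 0 (@Ordinal 3 0 isT).
Definition ycoord (v : vec) : K := v 0 (@Ordinal 3 1 isT).
Definition zcoord (v : vec) : K := v 0 (@Ordinal 3 2 isT).

Definition Qform (v : vec) : K := xcoord v * zcoord v - ycoord v ^+ 2.
Definition Bform (v w : vec) : K := 2%:R^-1 * (Qform (v + w) - Qform (v - w)).

Definition square_class (alpha : K) : set K :=
  [set alpha * t ^+ 2 | t in @nonzero K].

Definition even_valuation (x : K) : Prop :=
  exists m : int, padic_abs x = p%:R ^ (2 * m).

(* From here on, alpha is a representative of its square class. *)
Variable alpha : K.

Definition Kgroup : set K :=
  [set t | t != 0 /\ exists x y : K,
     [/\ x != 0, y != 0 & t = alpha * x ^+ 2 + y ^+ 2]].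

Definition cone1 : set vec :=
  [set w | w != 0 /\ exists a b c : K,
     [/\ w = vec3 a b c, a * c = b ^+ 2,
         (exists s, a = s ^+ 2) & (exists t, c = t ^+ 2)]].

Definition Hset : set vec := [set v | forall w, cone1 w -> Kgroup (Bform v w)].

Definition disc : set (set vec) := [set scale_class Kgroup v | v in Hset].

Definition sym_mx (v : vec) : 'M[K]_2 :=
  \matrix_(i < 2, j < 2) [:: xcoord v; ycoord v; zcoord v]`_(i + j).
Definition mx_sym (S : 'M[K]_2) : vec := vec3 (S 0 0) (S 0 1) (S 1 1).

Definition Ad (g : 'M[K]_2) (v : vec) : vec :=
  mx_sym ((\det g)^-1 *: (g *m sym_mx v *m g^T)).

(* If G is the class of g and x that of v, this is the class of
   det(g) Ad(g) v, since the nonzero squares belong to Kgroup. *)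
Definition disc_act (G : set 'M[K]_2) (x : set vec) : set vec :=
  [set \det g *: Ad g v | g in G & v in x].

Definition long_line : set (set (set vec)) :=
  [set l | l !=set0 /\ exists P : {vspace vec},
     [/\ \dim P = 2%N,
         (exists v, [/\ v \in P, v != 0 & Qform v = 0]) &
         l = disc `&` [set scale_class Kgroup v |
                         v in [set v | v \in P /\ v != 0]]]].

(* A point of (dual \ {0}) / K takes at a point of the disc a value in k^* / K,
   so any representatives may be used to test membership in K. *)
Definition dual_disc : set (set dual) :=
  [set F | (exists2 phi : dual, phi != 0 & F = scale_class Kgroup phi) /\
     forall x, disc x -> forall phi v, F phi -> x v -> Kgroup (phi v)].

(* The value of t does not change when phi, phi', u or v is multiplied by an
   element of Kgroup: only the classes F, F', x and y matter. *)
Definition cross_ratios (x y : set vec) : set K :=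
  [set t | exists (F F' : set dual), [/\ dual_disc F, dual_disc F' &
     exists (phi phi' : dual) (u v : vec),
       [/\ F phi, F' phi', x u, y v &
           t = (phi v / phi u) * (phi' u / phi' v)]]].

Definition symmetric_ball (r : R) : set K :=
  [set t | [/\ Kgroup t, padic_abs (t - 1) <= r & padic_abs (t^-1 - 1) <= r]].

(* The symmetric balls are nested, so the intersection taken by [smallest] is
   the smallest symmetric ball containing the cross ratios. *)
Definition hilbert_dist (mu : set (kstar_borel K) -> \bar R)
    (x y : set vec) : \bar R :=
  mu [set t | smallest [set symmetric_ball r | r in [set r : R | 0 <= r]]
                (cross_ratios x y) (kval t)].

End Disc.
Arguments disc_act {R p} K.

Definition quasi_isometry (R : realType) (X Y : Type) (A : set X) (B : set Y)
    (dX : X -> X -> \bar R) (dY : Y -> Y -> \bar R) (f : X -> Y) : Prop :=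
  exists c : R, exists k : R, [/\ 1 <= c, 0 <= k,
    (forall x x', A x -> A x' ->
       (c^-1%:E * dX x x' - k%:E <= dY (f x) (f x'))%E /\
       (dY (f x) (f x') <= c%:E * dX x x' + k%:E)%E) &
    (forall y, B y -> exists2 x, A x & (dY y (f x) <= k%:E)%E)].

(* Main.v *)
Require Import Defs.
From HB Require Import structures.
From mathcomp Require Import all_boot all_order all_algebra fingroup cyclic.
From mathcomp Require Import all_classical all_reals all_analysis.
From mathcomp Require Import ring lra zify.
Set Implicit Arguments.
Unset Strict Implicit.
Unset Printing Implicit Defensive.
Import Order.TTheory GRing.Theory Num.Theory.
Local Open Scope classical_set_scope.
Local Open Scope ring_scope.

(** Why the theorem holds.

    As [alpha] has even valuation and [- alpha] is not a square, [alpha x ^ 2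
    + y ^ 2] is the norm form of the unramified quadratic extension, and
    [Kgroup alpha] is the group of all elements of even valuation
    ([Kgroup_evE]).  Pairing a vector [v] with the rank one matrices [u u^T]
    of the cone gives the values of a binary quadratic form [qf v], so that
    [Hset alpha] is the set of forms [qf v] all of whose nonzero values have
    even valuation ([HsetE]).  Such a form is, up to a scalar, the norm of the
    unramified extension in some coordinates; [|qf v|] is the square of an
    ultrametric norm on the plane, and the unit ball of this norm is a lattice.
    The projection [proj] sends the class of [v] to the homothety class of this
    lattice.  It commutes with the group, so that the stabilizer of a point is
    contained in that of its image.

    Uniqueness.  The symmetric matrix [S] of [v], multiplied by the standard
    symplectic matrix, is a matrix [sqrt_mx v] of square [- Q v] which fixes the
    class of [v].  A lattice fixed up to homothety by [sqrt_mx v] is a module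
    over the integers of the unramified extension [K(sqrt (- Q v))]; these form
    a discrete valuation ring acting on a line, so the lattice is a ball of
    [qf v] ([fixed_class]).

    Distances.  For two points of the disc, a basis adapted to both lattices
    (elementary divisors) reduces everything to the lattices [<e1, e2>] and
    [<e1, p ^ n e2>].  Their distance in the tree is [n] ([tree_dist_span]).  A
    functional of the dual disc cannot vanish at a small perturbation of a point
    of the disc; this bounds all the cross ratios by [p ^ (2 n)]
    ([even_functional_bound]), and evaluation at [e1] and [e2] attains the
    bound.  For [n > 0] the Hilbert distance is therefore the Haar measure of
    the elements of even valuation between [- 2 n] and [2 n], that is
    [2 n + 1]; for [n = 0] it lies between [0] and [1].

    Lines.  A plane on which [Q] is isotropic and which meets the disc is
    spanned by two rank one matrices [u1 u1^T] and [u2 u2^T] ([long_lineE]).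
    Its forms are diagonal in the basis [u1, u2], with balls [<x u1, y u2>], so
    that it projects onto the geodesic with ends [u1] and [u2]
    ([chord_image]).  A geodesic determines its ends ([geo_end]), which
    determine the plane. *)

(** * Absolute values, residues and squares *)

Section Padic.
Variables (R : realType) (p : nat) (K : padicField R p).
Hypotheses (p_prime : prime p) (p_odd : odd p).
Local Notation abs := (@padic_abs R p K).
Local Notation P := (p%:R : R).

Lemma P_gt1 : 1 < P.
Proof. by rewrite ltr1n prime_gt1. Qed.

Lemma P_gt0 : 0 < P.
Proof. exact: lt_trans ltr01 P_gt1. Qed.

Lemma abs1 : abs 1 = 1.
Proof. by rewrite -[1]/(1%:R) padic_abs_nat // logn1 expr0 invr1. Qed.

Lemma abs_p : abs p%:R = P^-1.
Proof. by rewrite padic_abs_nat ?prime_gt0 // logn_prime // eqxx expr1. Qed.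

Lemma abs0 : abs 0 = 0.
Proof.
have h : abs 0 * (1 - P^-1) = 0.
  by rewrite mulrBr mulr1 -abs_p -padic_absM mul0r subrr.
move/eqP: h; rewrite mulf_eq0 => /orP[/eqP //|].
rewrite subr_eq0 => /eqP h; have := P_gt1.
by rewrite -[P]invrK -h invr1 ltxx.
Qed.

Lemma abs_eq0 x : (abs x == 0) = (x == 0).
Proof.
apply/eqP/eqP => [/padic_abs_eq0 //|->]; exact: abs0.
Qed.

Lemma abs_gt0 x : (0 < abs x) = (x != 0).
Proof. by rewrite lt_def padic_abs_ge0 andbT abs_eq0. Qed.

Lemma absX x n : abs (x ^+ n) = abs x ^+ n.
Proof. by elim: n => [|n IH]; rewrite ?expr0 ?abs1 // !exprS padic_absM IH. Qed.

Lemma absN x : abs (- x) = abs x.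
Proof.
suff h : abs (-1) = 1 by rewrite -mulN1r padic_absM h mul1r.
have : abs (-1) ^+ 2 = 1 by rewrite -absX sqrrN expr1n abs1.
by move/eqP; rewrite sqrp_eq1 ?padic_abs_ge0 // => /eqP.
Qed.

Lemma absBC x y : abs (x - y) = abs (y - x).
Proof. by rewrite -absN opprB. Qed.

Lemma absV x : abs x^-1 = (abs x)^-1.
Proof.
have [->|x0] := eqVneq x 0; first by rewrite invr0 abs0 invr0.
have h : abs x * abs x^-1 = 1 by rewrite -padic_absM divff // abs1.
by apply: (mulfI (x := abs x)); rewrite ?abs_eq0 // h divff // abs_eq0.
Qed.

Lemma absD_le x y r : abs x <= r -> abs y <= r -> abs (x + y) <= r.
Proof. by move=> hx hy; apply: le_trans (padic_absD x y) _; rewrite ge_max hx. Qed.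

Lemma absB_le x y r : abs x <= r -> abs y <= r -> abs (x - y) <= r.
Proof. by move=> hx hy; apply: absD_le; rewrite ?absN. Qed.

Lemma absD_lt x y r : abs x < r -> abs y < r -> abs (x + y) < r.
Proof. by move=> hx hy; apply: le_lt_trans (padic_absD x y) _; rewrite gt_max hx. Qed.

Lemma absD_dom x y : abs y < abs x -> abs (x + y) = abs x.
Proof.
move=> h; apply/eqP; rewrite eq_le absD_le //=; last exact: ltW.
rewrite leNgt; apply/negP => h2.
have := absD_lt h2 (_ : abs (- y) < _); rewrite absN addrK => /(_ h).
by rewrite ltxx.
Qed.

Lemma abs_near x y : abs (x - y) < abs x -> abs y = abs x.
Proof.
move=> h; rewrite -[RHS](absD_dom (y := y - x)); last by rewrite absBC.
by rewrite addrC subrK.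
Qed.

Lemma nat_neq0 n : (0 < n)%N -> n%:R != 0 :> K.
Proof.
move=> n0; rewrite -abs_gt0 padic_abs_nat // invr_gt0 exprn_gt0 //; exact: P_gt0.
Qed.

Lemma p_neq0 : p%:R != 0 :> K.
Proof. by rewrite nat_neq0 // prime_gt0. Qed.

Lemma two_neq0 : 2%:R != 0 :> K.
Proof. exact: nat_neq0. Qed.

Lemma abs_nat_coprime n : ~~ (p %| n)%N -> abs n%:R = 1.
Proof.
move=> h; rewrite padic_abs_nat; last by case: n h => //; rewrite dvdn0.
by rewrite lognE (negbTE h) !andbF expr0 invr1.
Qed.

Lemma abs2 : abs 2%:R = 1.
Proof.
apply: abs_nat_coprime; apply/negP => /(dvdn_leq (ltn0Sn _)).
by move: p_prime p_odd; case: (p) => [|[|[|]]].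
Qed.

Lemma abs_pexpz (m : int) : abs (p%:R ^ m) = P ^ (- m).
Proof.
case: m => n; first by rewrite -exprnP absX abs_p exprVn -exprnN.
by rewrite NegzE opprK -exprnN absV absX abs_p exprVn invrK exprnP.
Qed.

Lemma abs_int (z : int) : abs z%:~R = abs (`|z|%N)%:R.
Proof. by case: z => n //; rewrite NegzE mulrNz absN. Qed.

Lemma abs_int_le1 (z : int) : abs z%:~R <= 1.
Proof.
rewrite abs_int; case: (`|z|%N) => [|n]; first by rewrite abs0.
rewrite padic_abs_nat // invf_le1 ?exprn_gt0 ?P_gt0 // exprn_ege1 //.
exact/ltW/P_gt1.
Qed.

Lemma abs_int_lt1 (z : int) : (abs z%:~R < 1) = (z%:~R == 0 :> 'F_p).
Proof.
have -> : (z%:~R == 0 :> 'F_p) = ((`|z|%N)%:R == 0 :> 'F_p).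
  by case: z => n //; rewrite NegzE mulrNz oppr_eq0.
rewrite abs_int -(dvdn_pcharf (pchar_Fp p_prime)).
have [/dvdnP[k ->]|h] := boolP (p %| _)%N; last by rewrite abs_nat_coprime ?ltxx.
rewrite natrM padic_absM abs_p.
rewrite -[X in _ < X](@mulfV _ P) ?gt_eqF ?P_gt0 //.
rewrite ltr_pM2r ?invr_gt0 ?P_gt0 //; apply: le_lt_trans P_gt1.
by have := abs_int_le1 k.
Qed.

(** By density, an element has the absolute value of a rational number. *)
Lemma abs_val x : x != 0 -> exists m : int, abs x = P ^ m.
Proof.
move=> x0; have [q hq] := padic_dense x (e := abs x) ltac:(by rewrite abs_gt0).
rewrite -(abs_near hq) /ratr padic_absM absV !abs_int.
have q0 : numq q != 0.
  apply: contraTneq hq => h; rewrite /ratr h mul0r subr0 ltxx //.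
rewrite !padic_abs_nat ?absz_gt0 ?denq_neq0 // invrK.
exists (- (logn p `|numq q|%N)%:Z + (logn p `|denq q|%N)%:Z).
by rewrite expfzDr ?gt_eqF ?P_gt0 // -exprnN -exprnP.
Qed.

(** A nearby rational number has a denominator prime to [p], hence invertible
    modulo [p]. *)
Lemma residue x : abs x <= 1 -> exists n : nat, abs (x - n%:R) < 1.
Proof.
move=> x1; have [q hq] := padic_dense x (e := 1) ltr01.
have q1 : abs (ratr q) <= 1.
  rewrite -[ratr q](subKr x); apply: absB_le => //; exact: ltW.
have bu : abs (denq q)%:~R = 1.
  apply/eqP; rewrite eq_le abs_int_le1 leNgt /=; apply/negP => hb.
  have ha : abs (numq q)%:~R < 1.
    have h0 : (denq q)%:~R != 0 :> K.
      rewrite -abs_gt0 abs_int padic_abs_nat ?absz_gt0 ?denq_neq0 //.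
      by rewrite invr_gt0 exprn_gt0 // P_gt0.
    rewrite -[_%:~R](mulfVK h0) padic_absM; apply: le_lt_trans hb.
    by rewrite ler_piMl ?padic_abs_ge0.
  have := coprime_num_den q.
  have dv (z : int) : abs z%:~R < 1 -> (p %| `|z|)%N.
    move=> h; apply: contraTT h => h; by rewrite abs_int abs_nat_coprime ?ltxx.
  rewrite /coprime => /eqP h; have : (p %| 1)%N by rewrite -h dvdn_gcd !dv.
  by rewrite dvdn1 => /eqP h1; move: p_prime; rewrite h1.
pose r : 'F_p := (numq q)%:~R / (denq q)%:~R.
have dF : (denq q)%:~R != 0 :> 'F_p by rewrite -abs_int_lt1 bu ltxx.
have rE : (r : nat)%:R * (denq q)%:~R = (numq q)%:~R :> 'F_p by rewrite natr_Zp mulfVK.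
move: (r : nat) rE => n rE {r}; exists n.
rewrite -[x](subrK (ratr q)) -addrA; apply: absD_lt => //.
have : abs (numq q - n%:Z * denq q)%:~R < 1.
  by rewrite abs_int_lt1 rmorphB rmorphM /= -pmulrn rE subrr.
rewrite rmorphB rmorphM /= -pmulrn => h.
have d0 : (denq q)%:~R != 0 :> K by rewrite -abs_gt0 bu ltr01.
by rewrite /ratr -[_%:R](mulfK d0) -mulrBl padic_absM absV bu invr1 mulr1.
Qed.

(** Newton's iteration with the derivative frozen at [2], which is a unit: each
    step multiplies the error [u ^ 2 - x] by at most [e]. *)
Lemma hensel_sqrt x : abs (x - 1) < 1 -> exists y, x = y ^+ 2.
Proof.
set e := abs (x - 1) => e1.
have e0 : 0 <= e by exact: padic_abs_ge0.
pose u n := iter n (fun u => u - (u ^+ 2 - x) / 2%:R) 1.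
have half d : abs (d / 2%:R) = abs d by rewrite padic_absM absV abs2 invr1 mulr1.
have inv n : abs (u n - 1) <= e /\ abs (u n ^+ 2 - x) <= e ^+ n.+1.
  elim: n => [|n [IH1 IH2]].
    by rewrite /u /= subrr abs0 expr1n absBC expr1.
  rewrite /u iterS -/(u n); set d := u n ^+ 2 - x.
  have de : abs d <= e by apply: le_trans IH2 _; rewrite exprS ler_piMr // exprn_ile1 // ltW.
  split.
    rewrite addrAC; apply: absB_le => //; by rewrite half.
  have -> : (u n - d / 2%:R) ^+ 2 - x = - (d * (u n - 1)) + (d / 2%:R) ^+ 2.
    rewrite /d; field; exact: two_neq0.
  apply: absD_le.
    rewrite absN padic_absM exprSr; apply: ler_pM => //; exact: padic_abs_ge0.
  rewrite absX half expr2 exprSr; apply: ler_pM => //; exact: padic_abs_ge0.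
have step n k : abs (u (n + k)%N - u n) <= e ^+ n.
  elim: k => [|k IH]; first by rewrite addn0 subrr abs0 exprn_ge0.
  rewrite addnS -[u _.+1](subrK (u (n + k)%N)) -addrA; apply: absD_le => //.
  rewrite {1}/u iterS -/(u _) addrAC subrr sub0r absN half.
  apply: le_trans (inv (n + k)%N).2 _; apply: ler_wiXn2l => //; first exact: ltW.
  by rewrite -addnS leq_addr.
have small r : 0 < r -> exists N, forall n, (N <= n)%N -> e ^+ n < r.
  move=> r0; have h : `|e| < 1 by rewrite ger0_norm.
  have /cvgrPdist_lt /(_ r r0)[N _ hN] := cvg_expr h.
  exists N => n /hN; by rewrite sub0r normrN normrX (ger0_norm e0).
have [l hl] : exists l, forall r : R, 0 < r -> exists N, forall n,
      (N <= n)%N -> abs (u n - l) < r.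
  apply: padic_complete => r r0; have [N hN] := small r r0.
  exists N => m n Nm Nn; apply: le_lt_trans (hN N (leqnn N)).
  rewrite -[u m](subrK (u N)) -addrA; apply: absD_le.
    by rewrite -(subnKC Nm).
  by rewrite absBC -(subnKC Nn).
exists l; apply/eqP; rewrite -subr_eq0 -abs_eq0 eq_le padic_abs_ge0 andbT.
apply/ler_addgt0Pr => r r0; rewrite add0r.
have [N1 h1] := small r r0.
have [N2 h2] := hl (Num.min r 1) ltac:(by rewrite lt_min r0 ltr01).
pose n := maxn N1 N2.
have := h2 n (leq_maxr _ _); rewrite lt_min => /andP[a1 a2].
have -> : x - l ^+ 2 = (u n - l) * ((u n - l) + 2%:R * l) - (u n ^+ 2 - x) by ring.
have lu : abs l <= 1.
  have -> : l = u n - (u n - l) by ring.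
  apply: absB_le; last exact: ltW.
  rewrite -[u n](subrK 1); apply: absD_le; last by rewrite abs1.
  exact: le_trans (inv n).1 (ltW e1).
apply: absB_le; last first.
  apply: le_trans (inv n).2 _; apply/ltW/h1; by rewrite (leq_trans (leq_maxl N1 N2)).
rewrite padic_absM; apply: le_trans (ltW a1); rewrite ler_piMr ?padic_abs_ge0 //.
apply: absD_le; first exact: ltW.
by rewrite padic_absM abs2 mul1r.
Qed.

Definition is_square (x : K) := exists y, x = y ^+ 2.

(** The case of [x / w ^ 2] close to [1]. *)
Lemma square_near x w : abs (x - w ^+ 2) < abs (w ^+ 2) -> is_square x.
Proof.
move=> h; have w0 : w ^+ 2 != 0.
  by rewrite -abs_gt0; apply: le_lt_trans h; exact: padic_abs_ge0.
have [|y hy] := @hensel_sqrt (x / w ^+ 2).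
  rewrite -[1 in X in X < _](divff w0) -mulrBl padic_absM absV.
  by rewrite ltr_pdivrMr ?mul1r // abs_gt0.
by exists (w * y); rewrite exprMn -hy mulrC divfK.
Qed.

Lemma is_squareM x y : is_square x -> is_square y -> is_square (x * y).
Proof. by move=> [a ->] [b ->]; exists (a * b); rewrite exprMn. Qed.

Lemma is_square_mulr_sq c x : c != 0 -> is_square (c ^+ 2 * x) -> is_square x.
Proof.
move=> c0 [y hy]; exists (y / c); rewrite exprMn -hy exprVn mulrC mulKf //.
by rewrite sqrf_eq0.
Qed.

(** If the sum were smaller than both terms, then [- d b ^ 2] would be close to
    [a ^ 2], hence a square. *)
Lemma abs_norm_form d a b : ~ is_square (- d) ->
  abs (a ^+ 2 + d * b ^+ 2) = Num.max (abs a ^+ 2) (abs d * abs b ^+ 2).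
Proof.
move=> nd; rewrite -!absX -padic_absM.
case: (ltgtP (abs (a ^+ 2)) (abs (d * b ^+ 2))) => h.
- by rewrite addrC absD_dom.
- by rewrite absD_dom.
apply/eqP; rewrite eq_le absD_le ?h //= leNgt -h; apply/negP => lt.
apply: nd; have b0 : b != 0.
  apply: contraTneq lt => b0; move: h; rewrite b0 expr0n /= !mulr0 addr0 => ->.
  by rewrite abs0 ltxx.
apply: (is_square_mulr_sq b0); apply: (@square_near _ a).
by rewrite absBC mulrN opprK mulrC.
Qed.

(** The nonsquares are the odd powers of a generator of the cyclic group of
    units. *)
Lemma Fp_nonsquareM (a b : 'F_p) : a != 0 -> b != 0 ->
  (forall k, a <> k ^+ 2) -> (forall k, b <> k ^+ 2) -> exists k, a * b = k ^+ 2.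
Proof.
move=> a0 b0 na nb.
have /cyclicP[x hx] := field_unit_group_cyclic [group of [set: {unit 'F_p}]].
have pow c : c != 0 -> exists i, c = FinRing.uval x ^+ i.
  rewrite -unitfE => uc.
  have : FinRing.unit 'F_p uc \in <[x]>%g by rewrite -hx inE.
  move=> /cycleP[i hi]; exists i; by rewrite -FinRing.val_unitX -hi.
have [[i hi] [j hj]] := (pow a a0, pow b b0).
have odd_i c k : c = FinRing.uval x ^+ k -> (forall k, c <> k ^+ 2) -> odd k.
  move=> hc nc; apply/negPn/negP => /negbTE ok.
  apply: (nc (FinRing.uval x ^+ k./2)).
  by rewrite -exprM muln2 hc -[in LHS](odd_double_half k) ok.
exists (FinRing.uval x ^+ ((i + j)./2)).
rewrite -exprM muln2 hi hj -exprD -[in LHS](odd_double_half (i + j)).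
by rewrite oddD (odd_i _ _ hi na) (odd_i _ _ hj nb).
Qed.

(** Being a square is decided modulo [p], by [square_near]. *)
Lemma unit_nonsquareM u w : abs u = 1 -> abs w = 1 ->
  ~ is_square u -> ~ is_square w -> is_square (u * w).
Proof.
move=> u1 w1 nu nw.
have [i hi] := residue (x := u) ltac:(by rewrite u1).
have [j hj] := residue (x := w) ltac:(by rewrite w1).
have i1 : abs i%:R = 1 by rewrite -u1; apply: abs_near; rewrite u1.
have j1 : abs j%:R = 1 by rewrite -w1; apply: abs_near; rewrite w1.
have dist (m n : nat) : (m%:R = n%:R :> 'F_p) -> abs (m%:R - n%:R) < 1.
  move=> h; have -> : m%:R - n%:R = (m%:Z - n%:Z)%:~R :> K by rewrite rmorphB /= -!pmulrn.
  by rewrite abs_int_lt1 rmorphB /= -!pmulrn h subrr.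
have nz (m : nat) : abs m%:R = 1 -> m%:R != 0 :> 'F_p.
  by move=> h; rewrite [m%:R]pmulrn -abs_int_lt1 -pmulrn h ltxx.
have sq x (m : nat) : abs x = 1 -> abs (x - m%:R) < 1 ->
    forall k : 'F_p, m%:R = k ^+ 2 -> is_square x.
  move=> x1 hx k hk; have hkm : abs (m%:R - (k : nat)%:R ^+ 2) < 1.
    by rewrite -natrX; apply: dist; rewrite natrX natr_Zp.
  have h : abs (x - (k : nat)%:R ^+ 2) < 1.
    by rewrite -[x](subrK m%:R) -addrA; apply: absD_lt.
  by apply: (square_near (w := (k : nat)%:R)); rewrite (abs_near (y := _ ^+ 2) (x := x)) x1.
have [||k hk] := @Fp_nonsquareM i%:R j%:R (nz i i1) (nz j j1); last 1 first.
- apply: (sq _ (i * j)%N _ _ k); rewrite ?padic_absM ?u1 ?w1 ?mulr1 ?natrM //.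
  have -> : u * w - i%:R * j%:R = (u - i%:R) * w + i%:R * (w - j%:R) by ring.
  by apply: absD_lt; rewrite padic_absM ?w1 ?i1 ?mulr1 ?mul1r.
- move=> k hk; exact: nu (sq _ _ u1 hi k hk).
- move=> k hk; exact: nw (sq _ _ w1 hj k hk).
Qed.

(** * The group of elements of even valuation *)

Local Notation ev := (@even_valuation R p K).

Lemma P_neq0 : P != 0.
Proof. by rewrite gt_eqF // P_gt0. Qed.

Lemma ev_neq0 x : ev x -> x != 0.
Proof. by move=> [m hm]; rewrite -abs_gt0 hm exprz_gt0 // P_gt0. Qed.

Lemma ev_abs x y : abs x = abs y -> ev x -> ev y.
Proof. by move=> h [m hm]; exists m; rewrite -h. Qed.

Lemma evM x y : ev x -> ev y -> ev (x * y).
Proof.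
by move=> [m hm] [n hn]; exists (m + n); rewrite padic_absM hm hn mulrDr expfzDr ?P_neq0.
Qed.

Lemma evV x : ev x -> ev x^-1.
Proof. by move=> [m hm]; exists (- m); rewrite absV hm mulrN invr_expz. Qed.

Lemma ev_sqr x : x != 0 -> ev (x ^+ 2).
Proof.
move=> /abs_val[m hm]; exists m; rewrite absX hm mulrC.
by rewrite -exprz_exp -exprnP.
Qed.

Lemma ev_unit x : abs x = 1 -> ev x.
Proof. by move=> h; exists 0; rewrite mulr0 expr0z. Qed.

Lemma ev1 : ev 1.
Proof. exact/ev_unit/abs1. Qed.

Lemma ev_abs_sqr x : ev x -> exists2 c : K, c != 0 & abs x = abs c ^+ 2.
Proof.
move=> [m hm]; exists (p%:R ^ (- m)); first by rewrite expfz_neq0 // p_neq0.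
by rewrite hm abs_pexpz opprK mulrC -exprz_exp -exprnP.
Qed.

Lemma ev_normalize x : ev x -> exists2 c : K, c != 0 & abs (c ^+ 2 * x) = 1.
Proof.
move=> /[dup] /ev_neq0 x0 /ev_abs_sqr[c c0 hc]; exists c^-1; first by rewrite invr_eq0.
by rewrite padic_absM absX absV exprVn -hc mulVf // abs_eq0.
Qed.

Lemma ev_norm_form d a b : ev d -> ~ is_square (- d) -> (a != 0) || (b != 0) ->
  ev (a ^+ 2 + d * b ^+ 2).
Proof.
move=> ed nd ab; have d0 : 0 < abs d by rewrite abs_gt0 ev_neq0.
have := abs_norm_form a b nd.
rewrite -!absX -padic_absM maxEle; case: ifP => h /esym /ev_abs; apply.
- apply: evM => //; apply: ev_sqr; apply: contraTneq ab => b0.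
  move: h; rewrite b0 expr0n mulr0 abs0 absX eqxx orbF => h.
  by rewrite negbK -abs_eq0 -sqrf_eq0 eq_le h exprn_ge0 // padic_abs_ge0.
- apply: ev_sqr; apply: contraFneq h => ->.
  by rewrite expr0n abs0 padic_abs_ge0.
Qed.

(** Take for [n] the least positive integer that is not a square: it is at most
    [p - 1], which is congruent to [-1], and its predecessor is a square. *)
Lemma nonsquare_sum_squares : ~ is_square (-1) -> exists r n : K,
  [/\ r != 0, abs n = 1, ~ is_square n & n = r ^+ 2 + 1].
Proof.
move=> n1; pose A n := `[< ~ is_square (n.+1)%:R >].
have pp : p = (p.-2).+2 by move: (prime_gt1 p_prime); case: (p) => [|[]].
have Ap : A (p.-2).
  apply/asboolP => -[w hw]; apply: n1; apply: (square_near (w := w)); rewrite -hw.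
  have -> : -1 - (p.-2.+1)%:R = - p%:R :> K.
    have -> : p%:R = (p.-2.+2)%:R :> K by rewrite -pp.
    by rewrite [in RHS]mulrS opprD.
  rewrite absN abs_p abs_nat_coprime; last by rewrite gtnNdvd // [X in (_ < X)%N]pp.
  by rewrite invf_lt1 ?P_gt0 // P_gt1.
have [m /asboolP hm mmin] := ex_minnP (ex_intro A _ Ap).
have m0 : (0 < m)%N.
  by rewrite lt0n; apply: contra_not_neq hm => ->; exists 1; rewrite expr1n.
have mp : (m.+1 < p)%N by rewrite pp ltnS ltnS; apply: mmin.
have [r hr] : is_square m%:R.
  apply: contrapT => h; have /mmin : A m.-1 by apply/asboolP; rewrite prednK.
  by rewrite leqNgt prednK // leqnn.
exists r, m.+1%:R; split=> //.
- by apply: contraTneq (nat_neq0 m0) => r0; rewrite hr r0 expr0n /= eqxx.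
- by apply: abs_nat_coprime; rewrite gtnNdvd.
- by rewrite -hr mulrSr.
Qed.

(** If [t] or [d t] is a square, one of the two coordinates can be taken equal
    to [p], as a small change of a square is a square.  Otherwise [d] is a
    square, as the squares have index two among the units, and [t] is a
    square times the sum of two squares of [nonsquare_sum_squares]. *)
Lemma Kgroup_unit d t : abs d = 1 -> ~ is_square (- d) -> abs t = 1 -> Kgroup d t.
Proof.
move=> d1 nd t1.
have nz x : abs x = 1 -> x != 0 by move=> h; rewrite -abs_gt0 h ltr01.
have d0 := nz _ d1; have t0 := nz _ t1.
have pp : abs (p%:R ^+ 2) < 1.
  by rewrite absX abs_p exprVn invf_lt1 ?exprn_gt0 ?exprn_egt1 ?P_gt0 ?P_gt1.
split => //.
have [[s hs]|nt] := pselect (is_square t).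
  have [y hy] : is_square (t - d * p%:R ^+ 2).
    apply: (square_near (w := s)); rewrite -hs t1 addrAC subrr sub0r absN.
    by rewrite padic_absM d1 mul1r.
  exists p%:R, y; split; [exact: p_neq0| |by rewrite -hy addrC subrK].
  rewrite -sqrf_eq0 -hy; apply: nz.
  by rewrite absD_dom // absN padic_absM d1 t1 mul1r.
have [[s hs]|ndt] := pselect (is_square (d * t)).
  have [x hx] : is_square ((t - p%:R ^+ 2) / d).
    apply: (square_near (w := s / d)); rewrite exprMn -hs.
    have -> : d * t * d^-1 ^+ 2 = t / d by field.
    rewrite padic_absM absV d1 t1 divr1 -mulrBl addrAC subrr sub0r.
    by rewrite padic_absM absV absN d1 divr1.
  exists x, p%:R; split; [|exact: p_neq0|by rewrite -hx mulrC divfK // subrK].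
  rewrite -sqrf_eq0 -hx; apply: nz.
  by rewrite padic_absM absV d1 divr1 absD_dom // absN t1.
have [a ha] : is_square d.
  by apply: contrapT => nsd; apply: ndt; exact: unit_nonsquareM.
have a0 : a != 0 by rewrite -sqrf_eq0 -ha.
have [|r [n [r0 n1 nn rn]]] := nonsquare_sum_squares.
  move=> h; apply: nd; rewrite -mulN1r; apply: is_squareM => //; by exists a.
have [s hs] := unit_nonsquareM t1 n1 nt nn.
have s0 : s != 0 by rewrite -sqrf_eq0 -hs mulf_neq0 // nz.
have n0 := nz _ n1; exists (s / n * r / a), (s / n); split.
- by rewrite !mulf_neq0 ?invr_eq0.
- by rewrite !mulf_neq0 ?invr_eq0.
- have -> : t = s ^+ 2 / n by rewrite -hs mulfK.
  rewrite ha !exprMn !exprVn -hs.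
  apply: (mulIf n0); rewrite divfK //.
  have -> : a ^+ 2 * (t * n * (n ^+ 2)^-1 * r ^+ 2 * (a ^+ 2)^-1) +
    t * n * (n ^+ 2)^-1 = t * n * (n ^+ 2)^-1 * (r ^+ 2 + 1) by field; rewrite n0.
  by rewrite -rn; field.
Qed.

Lemma nonsquare_opp alpha : alpha != 0 -> ~ square_class alpha (-1) ->
  ~ is_square (- alpha).
Proof.
move=> a0 na [y hy]; apply: na; have y0 : y != 0 by rewrite -sqrf_eq0 -hy oppr_eq0.
exists y^-1; first by rewrite /nonzero /= invr_eq0.
by rewrite exprVn -hy invrN mulrN divff.
Qed.

(** The form [alpha x ^ 2 + y ^ 2] is the norm of the unramified quadratic
    extension, whose norms are exactly the elements of even valuation. *)
Lemma Kgroup_evE alpha : ev alpha -> ~ is_square (- alpha) -> Kgroup alpha = ev.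
Proof.
move=> ea ns; have a0 := ev_neq0 ea.
apply/seteqP; split=> t.
  move=> [t0 [x [y [x0 y0 ->]]]]; rewrite addrC; apply: ev_norm_form => //.
  by rewrite y0.
move=> et; have [c c0 hc] := ev_normalize ea; have [e e0 he] := ev_normalize et.
have [|_ [x [y [x0 y0 h]]]] := Kgroup_unit hc _ he.
  by rewrite -mulrN => /(is_square_mulr_sq c0).
split; first exact: ev_neq0.
exists (x * c / e), (y / e); split; rewrite ?mulf_neq0 ?invr_eq0 //.
apply: (mulfI (x := e ^+ 2)); first by rewrite sqrf_eq0.
by rewrite h; field.
Qed.

(** * Symmetric matrices as binary quadratic forms *)

Local Notation form := 'rV[K]_3.
Local Notation vec := 'cV[K]_2.

Definition mkvec (a b : K) : vec := \col_(i < 2) [:: a; b]`_i.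

Lemma mkvec0 a b : mkvec a b 0 0 = a. Proof. by rewrite mxE. Qed.
Lemma mkvec1 a b : mkvec a b 1 0 = b. Proof. by rewrite mxE. Qed.

Lemma vecP (u w : vec) : u 0 0 = w 0 0 -> u 1 0 = w 1 0 -> u = w.
Proof.
move=> h0 h1; apply/matrixP => i j; rewrite (ord1 j).
case: i => -[|[|//]] hi.
- by rewrite (_ : Ordinal hi = 0) //; exact: val_inj.
- by rewrite (_ : Ordinal hi = 1) //; exact: val_inj.
Qed.

Lemma formP (v w : form) : xcoord v = xcoord w -> ycoord v = ycoord w ->
  zcoord v = zcoord w -> v = w.
Proof.
move=> h0 h1 h2; apply/matrixP => i j; rewrite (ord1 i).
case: j => -[|[|[|//]]] hj.
- by rewrite (_ : Ordinal hj = @Ordinal 3 0 isT) //; exact: val_inj.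
- by rewrite (_ : Ordinal hj = @Ordinal 3 1 isT) //; exact: val_inj.
- by rewrite (_ : Ordinal hj = @Ordinal 3 2 isT) //; exact: val_inj.
Qed.

Lemma xcoord_vec3 (a b c : K) : xcoord (vec3 a b c) = a. Proof. by rewrite /xcoord mxE. Qed.
Lemma ycoord_vec3 (a b c : K) : ycoord (vec3 a b c) = b. Proof. by rewrite /ycoord mxE. Qed.
Lemma zcoord_vec3 (a b c : K) : zcoord (vec3 a b c) = c. Proof. by rewrite /zcoord mxE. Qed.

Lemma xcoordD (v w : form) : xcoord (v + w) = xcoord v + xcoord w.
Proof. by rewrite /xcoord mxE. Qed.
Lemma ycoordD (v w : form) : ycoord (v + w) = ycoord v + ycoord w.
Proof. by rewrite /ycoord mxE. Qed.
Lemma zcoordD (v w : form) : zcoord (v + w) = zcoord v + zcoord w.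
Proof. by rewrite /zcoord mxE. Qed.
Lemma xcoordN (v : form) : xcoord (- v) = - xcoord v. Proof. by rewrite /xcoord mxE. Qed.
Lemma ycoordN (v : form) : ycoord (- v) = - ycoord v. Proof. by rewrite /ycoord mxE. Qed.
Lemma zcoordN (v : form) : zcoord (- v) = - zcoord v. Proof. by rewrite /zcoord mxE. Qed.
Lemma xcoordZ a (v : form) : xcoord (a *: v) = a * xcoord v.
Proof. by rewrite /xcoord mxE. Qed.
Lemma ycoordZ a (v : form) : ycoord (a *: v) = a * ycoord v.
Proof. by rewrite /ycoord mxE. Qed.
Lemma zcoordZ a (v : form) : zcoord (a *: v) = a * zcoord v.
Proof. by rewrite /zcoord mxE. Qed.

Definition coordE := (xcoord_vec3, ycoord_vec3, zcoord_vec3,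
  (xcoordD, ycoordD, zcoordD), (xcoordN, ycoordN, zcoordN),
  (xcoordZ, ycoordZ, zcoordZ)).

Lemma mulmx2E n (g : 'M[K]_2) (h : 'M[K]_(2, n)) i j :
  (g *m h) i j = g i 0 * h 0 j + g i 1 * h 1 j.
Proof.
rewrite mxE big_ord_recl big_ord1; congr (_ + g i _ * h _ j); exact: val_inj.
Qed.

Lemma det2E (g : 'M[K]_2) : \det g = g 0 0 * g 1 1 - g 0 1 * g 1 0.
Proof.
rewrite (expand_det_row _ 0) !big_ord_recl big_ord0 addr0 /cofactor !det_mx11 !mxE /=.
rewrite expr0 mul1r expr1 mulN1r mulrN.
by congr (_ * g _ _ - g _ _ * g _ _); exact: val_inj.
Qed.

Lemma mxDE m n (A B : 'M[K]_(m, n)) i j : (A + B) i j = A i j + B i j.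
Proof. exact: mxE. Qed.

Lemma mxZE m n c (A : 'M[K]_(m, n)) i j : (c *: A) i j = c * A i j.
Proof. exact: mxE. Qed.

Lemma mxTE m n (A : 'M[K]_(m, n)) i j : A^T i j = A j i.
Proof. exact: mxE. Qed.

Lemma mxNE m n (A : 'M[K]_(m, n)) i j : (- A) i j = - A i j.
Proof. exact: mxE. Qed.

Definition vecE := (mxDE, mxNE, mxZE, mxTE, mulmx2E, mkvec0, mkvec1).

(** This is [u^T adj(S) u], for [S] the symmetric matrix with coordinates
    [v]. *)
Definition qf (v : form) (u : vec) : K :=
  zcoord v * u 0 0 ^+ 2 - 2%:R * ycoord v * u 0 0 * u 1 0 + xcoord v * u 1 0 ^+ 2.

Definition det2 (u w : vec) : K := u 0 0 * w 1 0 - u 1 0 * w 0 0.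

(** The coordinates of the rank one matrix [u u^T]. *)
Definition sq (u : vec) : form := vec3 (u 0 0 ^+ 2) (u 0 0 * u 1 0) (u 1 0 ^+ 2).

(** Pairing with the cone thus evaluates the form [qf v]. *)
Lemma Bform_sq v u : Bform v (sq u) = qf v u.
Proof.
rewrite /Bform /Qform /qf /sq !coordE.
apply: (mulfI two_neq0); rewrite mulrA divff ?two_neq0 // mul1r; ring.
Qed.

Lemma qf_sq w u : qf (sq w) u = det2 w u ^+ 2.
Proof. rewrite /qf /sq /det2 !coordE; ring. Qed.

Lemma qfD v w u : qf (v + w) u = qf v u + qf w u.
Proof. rewrite /qf !coordE; ring. Qed.

Lemma qfZ c v u : qf (c *: v) u = c * qf v u.
Proof. rewrite /qf !coordE; ring. Qed.

Lemma qf_scale v c u : qf v (c *: u) = c ^+ 2 * qf v u.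
Proof. rewrite /qf !mxE; ring. Qed.

Lemma qf0 v : qf v 0 = 0.
Proof. by rewrite -(scale0r 0) qf_scale expr0n mul0r. Qed.

Lemma sqZ c u : sq (c *: u) = c ^+ 2 *: sq u.
Proof. by apply: formP; rewrite /sq !coordE !mxE; ring. Qed.

Lemma sq_eq0 u : sq u = 0 -> u = 0.
Proof.
move=> h; have : xcoord (sq u) = 0 by rewrite h /xcoord mxE.
have : zcoord (sq u) = 0 by rewrite h /zcoord mxE.
rewrite !coordE => /eqP; rewrite sqrf_eq0 => /eqP h1 /eqP; rewrite sqrf_eq0 => /eqP h0.
by apply: vecP; rewrite ?h0 ?h1 mxE.
Qed.

Lemma cone1E w : cone1 w <-> exists2 u : vec, u != 0 & w = sq u.
Proof.
split=> [[w0 [a [b [c [wE acb [s hs] [t ht]]]]]]|[u u0 ->]].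
  have [t' [tt bE]] : exists t', t' ^+ 2 = c /\ b = s * t'.
    have : (b - s * t) * (b + s * t) == 0 by rewrite -subr_sqr -acb hs ht exprMn subrr.
    rewrite mulf_eq0 => /orP[|].
      by rewrite subr_eq0 => /eqP ->; exists t.
    by rewrite addr_eq0 => /eqP ->; exists (- t); rewrite sqrrN mulrN.
  have ww : w = sq (mkvec s t') by rewrite wE /sq !vecE hs tt bE.
  exists (mkvec s t') => //; apply: contra_neq w0 => h0.
  by rewrite ww h0 -(scale0r 0) sqZ expr0n scale0r.
split; first by apply: contra_neq u0; exact: sq_eq0.
exists (u 0 0 ^+ 2), (u 0 0 * u 1 0), (u 1 0 ^+ 2); split=> //.
- by rewrite exprMn.
- by exists (u 0 0).
- by exists (u 1 0).
Qed.

Lemma det2_neq0l u w : det2 u w != 0 -> u != 0.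
Proof. by apply: contra_neq => ->; rewrite /det2 !mxE !mul0r subrr. Qed.

Lemma det2C u w : det2 u w = - det2 w u.
Proof. rewrite /det2; ring. Qed.

Lemma det2_neq0C u w : (det2 u w != 0) = (det2 w u != 0).
Proof. by rewrite det2C oppr_eq0. Qed.

Lemma det2_neq0r u w : det2 u w != 0 -> w != 0.
Proof. rewrite det2_neq0C; exact: det2_neq0l. Qed.

Lemma det2Zl c u w : det2 (c *: u) w = c * det2 u w.
Proof. rewrite /det2 !mxE; ring. Qed.

Lemma det2Zr c u w : det2 u (c *: w) = c * det2 u w.
Proof. rewrite /det2 !mxE; ring. Qed.

Lemma det2_comb u w a b c d :
  det2 (a *: u + b *: w) (c *: u + d *: w) = (a * d - b * c) * det2 u w.
Proof. rewrite /det2 !mxE; ring. Qed.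

Lemma cramer2 u w t : det2 u w != 0 ->
  t = (det2 t w / det2 u w) *: u + (det2 u t / det2 u w) *: w.
Proof.
rewrite /det2 => d0.
by apply: vecP; rewrite !mxE; field.
Qed.

Lemma basis2 u w t : det2 u w != 0 -> exists a b, t = a *: u + b *: w.
Proof. by move=> d0; exists (det2 t w / det2 u w), (det2 u t / det2 u w); exact: cramer2. Qed.

Lemma basis2_inj u w a b c d : det2 u w != 0 ->
  a *: u + b *: w = c *: u + d *: w -> a = c /\ b = d.
Proof.
move=> d0 h; split; apply: (mulIf d0).
  have e x y : det2 (x *: u + y *: w) w = x * det2 u w by rewrite /det2 !mxE; ring.
  by rewrite -(e a b) h e.
have e x y : det2 u (x *: u + y *: w) = y * det2 u w by rewrite /det2 !mxE; ring.
by rewrite -(e a b) h e.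
Qed.

Lemma det2_eq0 u w : u != 0 -> det2 u w = 0 -> exists c, w = c *: u.
Proof.
move=> u0; have [h0|h0] := eqVneq (u 0 0) 0.
  have h1 : u 1 0 != 0 by apply: contra_neq u0 => h1; apply: vecP; rewrite ?h0 ?h1 mxE.
  rewrite /det2 h0 mul0r sub0r => /eqP; rewrite oppr_eq0 mulf_eq0 (negbTE h1) /= => /eqP w0.
  by exists (w 1 0 / u 1 0); apply: vecP; rewrite !mxE ?h0 ?w0 ?mulr0 // divfK.
move=> /eqP; rewrite /det2 subr_eq0 => /eqP h.
exists (w 0 0 / u 0 0); apply: vecP; rewrite !mxE ?divfK //.
by rewrite mulrAC [w 0 0 * _]mulrC -h mulrAC divff // mul1r.
Qed.

(** The product [S J] of the symmetric matrix [S] of coordinates [v] and of the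
    standard symplectic matrix [J]: it has trace zero and determinant [Q v],
    hence is a square root of [- Q v], and it is a similitude of [qf v]. *)
Definition sqrt_mx (v : form) : 'M[K]_2 :=
  \matrix_(i < 2, j < 2)
    (nth [::] [:: [:: - ycoord v; xcoord v]; [:: - zcoord v; ycoord v]] i)`_j.

Lemma sqrt_mxE v : (sqrt_mx v 0 0 = - ycoord v) * (sqrt_mx v 0 1 = xcoord v) *
  (sqrt_mx v 1 0 = - zcoord v) * (sqrt_mx v 1 1 = ycoord v).
Proof. by rewrite !mxE. Qed.

Lemma det_sqrt_mx v : \det (sqrt_mx v) = Qform v.
Proof. rewrite det2E !sqrt_mxE /Qform; ring. Qed.

Lemma sqrt_mx_sqr v (u : vec) : sqrt_mx v *m (sqrt_mx v *m u) = - Qform v *: u.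
Proof. by apply: vecP; rewrite !vecE !sqrt_mxE /Qform; ring. Qed.

(** The form is the norm of the quadratic extension generated by [sqrt_mx v]. *)
Lemma qf_sqrt_mx v u a b :
  qf v (a *: u + b *: (sqrt_mx v *m u)) = (a ^+ 2 + Qform v * b ^+ 2) * qf v u.
Proof. rewrite /qf !vecE !sqrt_mxE /Qform; ring. Qed.

Lemma det2_sqrt_mx v u : det2 u (sqrt_mx v *m u) = - qf v u.
Proof. rewrite /det2 !mulmx2E !sqrt_mxE /qf; ring. Qed.

Definition gact (g : 'M[K]_2) (v : form) : form := \det g *: Ad g v.

Lemma sym_mxE (v : form) : (sym_mx v 0 0 = xcoord v) * (sym_mx v 0 1 = ycoord v) *
  (sym_mx v 1 0 = ycoord v) * (sym_mx v 1 1 = zcoord v).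
Proof. by rewrite !mxE. Qed.

Lemma gactE g v : g \in unitmx -> gact g v = mx_sym (g *m sym_mx v *m g^T).
Proof.
rewrite unitmxE unitfE => d0; apply: formP; rewrite /gact /Ad /mx_sym !coordE !mxE mulVKf //.
Qed.

Lemma qf_gact g v u : g \in unitmx ->
  qf (gact g v) (g *m u) = \det g ^+ 2 * qf v u.
Proof.
move=> gu; rewrite gactE // /mx_sym /qf !coordE !vecE !sym_mxE det2E; ring.
Qed.

Lemma gact_sqrt_mx v : Qform v != 0 -> gact (sqrt_mx v) v = Qform v *: v.
Proof.
move=> q0; have tu : sqrt_mx v \in unitmx by rewrite unitmxE unitfE det_sqrt_mx.
rewrite gactE //; apply: formP; rewrite /mx_sym !coordE !vecE !sym_mxE !sqrt_mxE /Qform; ring.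
Qed.

Lemma gactZ g c v : gact g (c *: v) = c *: gact g v.
Proof.
by rewrite /gact; apply: formP; rewrite /Ad /mx_sym !coordE !vecE !sym_mxE !coordE; ring.
Qed.

Lemma gact_scale c g v : c != 0 -> g \in unitmx -> gact (c *: g) v = c ^+ 2 *: gact g v.
Proof.
move=> c0 gu; have cu : c *: g \in unitmx by rewrite unitmxZ // unitfE.
by rewrite !gactE //; apply: formP; rewrite /mx_sym !coordE !vecE !sym_mxE; ring.
Qed.

(** * Forms with values of even valuation *)

Local Notation Zp := (@Defs.Zp R p K).

Implicit Types (u w s t : vec) (v : form) (L M : set vec) (g : 'M[K]_2).
Implicit Types (a b c d k : K) (r : R).

Definition even_form (v : form) := forall u : vec, u != 0 -> ev (qf v u).

Lemma even_form_neq0 v u : even_form v -> u != 0 -> qf v u != 0.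
Proof. by move=> hv u0; apply/ev_neq0/hv. Qed.

Lemma mkvec_neq0l a b : a != 0 -> mkvec a b != 0.
Proof. by apply: contra_neq => h; rewrite -(mkvec0 a b) h mxE. Qed.

Lemma mkvec_neq0r a b : b != 0 -> mkvec a b != 0.
Proof. by apply: contra_neq => h; rewrite -(mkvec1 a b) h mxE. Qed.

(** Completing the square: [Q v / z] is a value of the form, and so is [0] if
    [- Q v] is a square. *)
Lemma even_form_Qform v : even_form v -> ev (Qform v) /\ ~ is_square (- Qform v).
Proof.
move=> hv; set x := xcoord v; set y := ycoord v; set z := zcoord v.
have ez : ev z.
  have := hv (mkvec 1 0) (mkvec_neq0l _ (oner_neq0 _)).
  by rewrite /qf !vecE expr1n expr0n /= !mulr0 mulr1 subr0 addr0.
have z0 := ev_neq0 ez.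
have key (s : K) : qf v (mkvec ((y + s) / z) 1) = (Qform v + s ^+ 2) / z.
  by rewrite /qf !vecE /Qform -/x -/y -/z; field.
split; last first.
  move=> [t ht]; have := hv (mkvec ((y + t) / z) 1) (mkvec_neq0r _ (oner_neq0 _)).
  by rewrite key -ht subrr mul0r => /ev_neq0; rewrite eqxx.
have := hv (mkvec ((y + 0) / z) 1) (mkvec_neq0r _ (oner_neq0 _)).
by rewrite key expr0n addr0 => /(evM ez); rewrite mulrC divfK.
Qed.

Lemma even_formZ k v : ev k -> even_form v -> even_form (k *: v).
Proof. by move=> ek hv u u0; rewrite qfZ; apply: evM => //; exact: hv. Qed.

Lemma even_form_gact g v : g \in unitmx -> even_form v -> even_form (gact g v).
Proof.
move=> gu hv u u0; rewrite -(mulKVmx gu u) qf_gact //; apply: evM.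
  by apply: ev_sqr; rewrite -unitfE -unitmxE.
by apply: hv; apply: contra_neq u0 => h; rewrite -(mulKVmx gu u) h mulmx0.
Qed.

Lemma even_form_neq0v v : even_form v -> v != 0.
Proof.
move=> /even_form_Qform[/ev_neq0 + _]; apply: contra_neq => ->.
by rewrite /Qform /xcoord /ycoord !mxE mul0r expr0n subr0.
Qed.

Lemma HsetE alpha : Kgroup alpha = ev -> Hset alpha = even_form.
Proof.
move=> KE; apply/seteqP; split=> v.
  move=> hv u u0; rewrite -KE -Bform_sq; apply: hv; apply/cone1E; by exists u.
by move=> hv w /cone1E[u u0 ->]; rewrite KE Bform_sq; exact: hv.
Qed.

(** * Lattices *)

Definition dilate (c : K) (L : set vec) : set vec := [set c *: u | u in L].
Definition mximg (g : 'M[K]_2) (L : set vec) : set vec := [set g *m u | u in L].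

Lemma ZpE (a : K) : Zp a = (abs a <= 1). Proof. by []. Qed.

Lemma Zp1 : Zp 1. Proof. by rewrite ZpE abs1. Qed.
Lemma Zp0 : Zp 0. Proof. by rewrite ZpE abs0. Qed.

Lemma Zp_spanP u w a b : det2 u w != 0 ->
  Zp_span u w (a *: u + b *: w) <-> Zp a /\ Zp b.
Proof.
move=> d0; split=> [[a' ha' [b' hb' h]]|[ha hb]]; last by exists a => //; exists b.
by have [<- <-] := basis2_inj d0 h.
Qed.

Lemma Zp_spanl u w : Zp_span u w u.
Proof.
exists 1; first exact: Zp1.
by exists 0; [exact: Zp0|rewrite scale1r scale0r addr0].
Qed.

Lemma Zp_spanr u w : Zp_span u w w.
Proof.
exists 0; first exact: Zp0.
by exists 1; [exact: Zp1|rewrite scale1r scale0r add0r].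
Qed.

Lemma Zp_span_comb u w a b s t : Zp_span u w s -> Zp_span u w t -> Zp a -> Zp b ->
  Zp_span u w (a *: s + b *: t).
Proof.
move=> [a1 h1 [b1 k1 <-]] [a2 h2 [b2 k2 <-]] ha hb.
have ZpD (x y z k : K) : Zp x -> Zp y -> Zp z -> Zp k -> Zp (x * y + z * k).
  by rewrite !ZpE => ? ? ? ?; apply: absD_le; rewrite padic_absM mulr_ile1 ?padic_abs_ge0.
exists (a * a1 + b * a2); first exact: ZpD.
exists (a * b1 + b * b2); first exact: ZpD.
by apply: vecP; rewrite !vecE; ring.
Qed.

Lemma Zp_span_sub u w s t : Zp_span u w s -> Zp_span u w t ->
  Zp_span s t `<=` Zp_span u w.
Proof. by move=> hs ht _ [a ha [b hb <-]]; exact: Zp_span_comb. Qed.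

Lemma dilate_span c u w : dilate c (Zp_span u w) = Zp_span (c *: u) (c *: w).
Proof.
apply/seteqP; split=> t.
  move=> [_ [a ha [b hb <-]] <-]; exists a => //; exists b => //.
  by apply: vecP; rewrite !vecE; ring.
move=> [a ha [b hb <-]]; exists (a *: u + b *: w); first by exists a => //; exists b.
by apply: vecP; rewrite !vecE; ring.
Qed.

(** Vectors dependent over the field are dependent over its integers, after
    division by the larger coefficient. *)
Lemma latticeP L : is_lattice L <->
  exists u w, det2 u w != 0 /\ L = Zp_span u w.
Proof.
split=> [[u [w [free ->]]]|[u [w [d0 ->]]]]; exists u, w; split=> //; last first.
  move=> a b _ _ h; apply: (basis2_inj d0); by rewrite h !scale0r addr0.
apply/negP => /eqP d0; have u0 : u != 0.
  apply/negP => /eqP u0; have [] := free 1 0 Zp1 Zp0.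
    by rewrite u0 scaler0 scale0r addr0.
  by move/eqP; rewrite oner_eq0.
have [c wE] := det2_eq0 u0 d0.
have [c1|c1] := lerP (abs c) 1.
  have [] := free (- c) 1 _ Zp1; first by rewrite ZpE absN.
    by rewrite wE scaleNr scale1r addNr.
  by move=> _ /eqP; rewrite oner_eq0.
have c0 : c != 0 by rewrite -abs_gt0 (lt_trans ltr01).
have [] := free (-1) c^-1; first by rewrite ZpE absN abs1.
- by rewrite ZpE absV invf_le1 ?abs_gt0 // ltW.
- by rewrite wE scaleN1r scalerA mulVf // scale1r addNr.
- by move/eqP; rewrite oppr_eq0 oner_eq0.
Qed.

Lemma lattice_span u w : det2 u w != 0 -> is_lattice (Zp_span u w).
Proof. by move=> d0; apply/latticeP; exists u, w. Qed.

Lemma tree_class L : is_lattice L -> tree K (homothety_class L).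
Proof. by move=> hL; exists L. Qed.

Lemma dilate1 L : dilate 1 L = L.
Proof.
apply/seteqP; split=> u; first by move=> [w hw <-]; rewrite scale1r.
by exists u; rewrite ?scale1r.
Qed.

Lemma dilateM c d L : dilate c (dilate d L) = dilate (c * d) L.
Proof.
apply/seteqP; split=> u.
  by move=> [_ [w hw <-] <-]; exists w; rewrite // scalerA.
by move=> [w hw <-]; exists (d *: w); [exists w|rewrite scalerA].
Qed.

Lemma dilateK c L : c != 0 -> dilate c^-1 (dilate c L) = L.
Proof. by move=> c0; rewrite dilateM mulVf // dilate1. Qed.

Lemma mximg_dilate g c L : mximg g (dilate c L) = dilate c (mximg g L).
Proof.
apply/seteqP; split=> u.
  by move=> [_ [w hw <-] <-]; exists (g *m w); [exists w|rewrite scalemxAr].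
by move=> [_ [w hw <-] <-]; exists (c *: w); [exists w|rewrite scalemxAr].
Qed.

Lemma mximg_scale c g L : mximg (c *: g) L = dilate c (mximg g L).
Proof.
apply/seteqP; split=> u.
  by move=> [w hw <-]; exists (g *m w); [exists w|rewrite scalemxAl].
by move=> [_ [w hw <-] <-]; exists w; rewrite // scalemxAl.
Qed.

Lemma mem_class L : homothety_class L L.
Proof. by exists 1; [exact: oner_neq0|exact: dilate1]. Qed.

Lemma class_dilate c L : c != 0 -> homothety_class (dilate c L) = homothety_class L.
Proof.
move=> c0; apply/seteqP; split=> M [d d0 <-].
  by exists (d * c); [exact: mulf_neq0|exact/esym/dilateM].
exists (d / c); first by rewrite /nonzero /= mulf_neq0 ?invr_eq0.
by rewrite -[LHS]/(dilate _ _) dilateM divfK.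
Qed.

Lemma class_eq L M : homothety_class L = homothety_class M ->
  exists2 c : K, c != 0 & M = dilate c L.
Proof. by move=> h; have := mem_class M; rewrite -h => -[c c0 hc]; exists c. Qed.

Lemma tree_act_class g L :
  tree_act K (scale_class (@nonzero K) g) (homothety_class L) =
  homothety_class (mximg g L).
Proof.
apply/seteqP; split=> M.
  move=> [_ [c c0 <-] [_ [d d0 <-] <-]]; exists (c * d); first exact: mulf_neq0.
  by rewrite -[RHS]/(mximg (c *: g) (dilate d L)) mximg_scale mximg_dilate dilateM.
move=> [c c0 <-]; exists (c *: g); first by exists c.
by exists L; [exact: mem_class|exact: mximg_scale].
Qed.

(** * The projection *)

Definition ball (v : form) (r : R) : set vec := [set w | abs (qf v w) <= r].

Lemma dilate_ball c v r : c != 0 -> dilate c (ball v r) = ball v (abs c ^+ 2 * r).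
Proof.
move=> c0; have c2 : 0 < abs c ^+ 2 by rewrite exprn_gt0 // abs_gt0.
apply/seteqP; split=> u.
  by move=> [w hw <-]; rewrite /ball /= qf_scale padic_absM absX ler_pM2l.
rewrite /ball /= => h; exists (c^-1 *: u); last by rewrite scalerA divff // scale1r.
by rewrite /ball /= qf_scale padic_absM absX absV exprVn mulrC ler_pdivrMr // mulrC.
Qed.

Lemma mximg_ball g v r : g \in unitmx ->
  mximg g (ball v r) = ball (gact g v) (abs (\det g) ^+ 2 * r).
Proof.
move=> gu; have d0 : 0 < abs (\det g) ^+ 2.
  by rewrite exprn_gt0 // abs_gt0 -unitfE -unitmxE.
apply/seteqP; split=> u.
  by move=> [w hw <-]; rewrite /ball /= qf_gact // padic_absM absX ler_pM2l.
rewrite /ball /= => h; exists (invmx g *m u); last by rewrite mulKVmx.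
by move: h; rewrite -{1}(mulKVmx gu u) qf_gact // padic_absM absX ler_pM2l.
Qed.

Lemma ball_scale k v r : k != 0 -> ball (k *: v) (abs k * r) = ball v r.
Proof.
move=> k0; apply/seteqP; split=> u; by rewrite /ball /= qfZ padic_absM ler_pM2l ?abs_gt0.
Qed.

(** With [c sqrt_mx v] as square root of the unit [- c ^ 2 Q v], the plane is a
    line over the unramified quadratic extension, whose integers have the basis
    given by [1] and this root; the balls are the cyclic modules over these
    integers. *)
Lemma ball_span v u c : even_form v -> u != 0 -> abs (c ^+ 2 * Qform v) = 1 ->
  ball v (abs (qf v u)) = Zp_span u (c *: (sqrt_mx v *m u)).
Proof.
move=> hv u0 hc; have q0 : 0 < abs (qf v u) by rewrite abs_gt0 even_form_neq0.
have c0 : c != 0 by apply: contra_eq_neq hc => ->; rewrite expr0n mul0r abs0 eq_sym oner_neq0.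
have d0 : det2 u (c *: (sqrt_mx v *m u)) != 0.
  by rewrite det2Zr det2_sqrt_mx mulf_neq0 // oppr_eq0 -abs_gt0.
have nQ := (even_form_Qform hv).2.
have key a b : ball v (abs (qf v u)) (a *: u + b *: (c *: (sqrt_mx v *m u))) <->
    Zp a /\ Zp b.
  rewrite /ball /= scalerA qf_sqrt_mx padic_absM ger_pMl // abs_norm_form //.
  have -> : abs (Qform v) * abs (b * c) ^+ 2 = abs b ^+ 2.
    by rewrite padic_absM exprMn -[RHS]mulr1 -hc padic_absM absX; ring.
  rewrite ge_max !expr_le1 ?padic_abs_ge0 //; split; first by move=> /andP[].
  by move=> [ha hb]; apply/andP.
apply/seteqP; split=> w; have [a [b ->]] := basis2 w d0.
  by move=> /key h; apply/(Zp_spanP _ _ d0).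
by move=> /(Zp_spanP _ _ d0) h; apply/key.
Qed.

Lemma ball_span_basis v u : even_form v -> u != 0 -> exists c, c != 0 /\
  abs (c ^+ 2 * Qform v) = 1 /\ det2 u (c *: (sqrt_mx v *m u)) != 0.
Proof.
move=> hv u0; have [c c0 hc] := ev_normalize (even_form_Qform hv).1.
by exists c; rewrite det2Zr det2_sqrt_mx mulf_neq0 // oppr_eq0 even_form_neq0.
Qed.

Definition proj (v : form) := homothety_class (ball v 1).

Lemma proj_ball v c : c != 0 -> homothety_class (ball v (abs c ^+ 2)) = proj v.
Proof. by move=> c0; rewrite -[_ ^+ 2]mulr1 -dilate_ball // class_dilate. Qed.

Lemma proj_ball_val v u : even_form v -> u != 0 ->
  homothety_class (ball v (abs (qf v u))) = proj v.
Proof. by move=> hv /hv/ev_abs_sqr[c c0 ->]; exact: proj_ball. Qed.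

Lemma proj_scale k v : ev k -> proj (k *: v) = proj v.
Proof.
move=> /[dup] /ev_neq0 k0 /ev_abs_sqr[c c0 hc].
by rewrite -(proj_ball _ c0) -hc -[abs k]mulr1 ball_scale.
Qed.

Lemma vec_neq0 : exists u : vec, u != 0.
Proof. by exists (mkvec 1 0); apply: mkvec_neq0l; exact: oner_neq0. Qed.

Lemma proj_tree v : even_form v -> tree K (proj v).
Proof.
move=> hv; have [u u0] := vec_neq0; have [c [c0 [hc d0]]] := ball_span_basis hv u0.
rewrite -(proj_ball_val hv u0) (ball_span hv u0 hc); exact/tree_class/lattice_span.
Qed.

Lemma proj_gact g v : g \in unitmx ->
  tree_act K (scale_class (@nonzero K) g) (proj v) = proj (gact g v).
Proof.
move=> gu; rewrite tree_act_class mximg_ball // mulr1 proj_ball //.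
by rewrite -unitfE -unitmxE.
Qed.

(** Balls are lattices, so [|qf v|] is ultrametric. *)
Lemma qf_max v u w a b : even_form v -> abs (qf v w) <= abs (qf v u) -> u != 0 ->
  Zp a -> Zp b -> abs (qf v (a *: u + b *: w)) <= abs (qf v u).
Proof.
move=> hv h u0 ha hb; have [c [c0 [hc d0]]] := ball_span_basis hv u0.
have bE := ball_span hv u0 hc.
have hw : ball v (abs (qf v u)) w by [].
have hu : ball v (abs (qf v u)) u by rewrite /ball /=.
suff : ball v (abs (qf v u)) (a *: u + b *: w) by [].
by move: hw hu; rewrite bE => hw hu; exact: Zp_span_comb.
Qed.

(** The maximum is attained at one of two basis vectors. *)
Lemma lattice_max v M : even_form v -> is_lattice M ->
  exists u, [/\ u != 0, M u & M `<=` ball v (abs (qf v u))].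
Proof.
move=> hv /latticeP[u [w [d0 ->]]].
have [h|h] := lerP (abs (qf v w)) (abs (qf v u)).
  exists u; split; [exact: det2_neq0l d0|exact: Zp_spanl|].
  by move=> _ [a ha [b hb <-]]; apply: qf_max => //; exact: det2_neq0l d0.
exists w; split; [exact: det2_neq0r d0|exact: Zp_spanr|].
move=> _ [a ha [b hb <-]]; rewrite addrC; apply: qf_max => //; first exact: ltW.
exact: det2_neq0r d0.
Qed.

Lemma lattice_comb M u w a b : is_lattice M -> M u -> M w -> Zp a -> Zp b ->
  M (a *: u + b *: w).
Proof. by move=> /latticeP[s [t [_ ->]]]; exact: Zp_span_comb. Qed.

(** After scaling, [e sqrt_mx v] preserves [M]; if [u] is a point of [M] where
    [|qf v|] is largest, then [M] contains the module generated by [u], which is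
    a ball containing [M]. *)
Lemma fixed_class v M : even_form v -> is_lattice M ->
  (exists2 c : K, c != 0 & mximg (sqrt_mx v) M = dilate c M) -> homothety_class M = proj v.
Proof.
move=> hv hM [c c0 hT].
have [u [u0 Mu Mle]] := lattice_max hv hM.
have [e [e0 [he d0]]] := ball_span_basis hv u0.
have q0 : 0 < abs (qf v u) by rewrite abs_gt0 even_form_neq0.
have T2 (w : vec) : M w -> exists2 w', M w' & sqrt_mx v *m (sqrt_mx v *m w) = c ^+ 2 *: w'.
  move=> Mw; have : mximg (sqrt_mx v) M (sqrt_mx v *m w) by exists w.
  rewrite hT => -[w1 M1 h1]; have : mximg (sqrt_mx v) M (sqrt_mx v *m w1) by exists w1.
  rewrite hT => -[w2 M2 h2]; exists w2 => //.
  by rewrite -h1 -scalemxAr -h2 scalerA expr2.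
(* Comparison of the maxima of [|qf v|] on both sides of [c ^ 2 M = Q(v) M],
   as [sqrt_mx v] has square [- Q(v)]. *)
have cQ : abs (c ^+ 2) = abs (Qform v).
  apply: le_anti; apply/andP; split; last first.
    have [w' Mw' h] := T2 u Mu; have := Mle _ Mw'; rewrite /ball /= => hw'.
    move: h; rewrite sqrt_mx_sqr => /(congr1 (fun x => abs (qf v x))).
    rewrite !qf_scale sqrrN 2!padic_absM => h.
    have : abs (Qform v ^+ 2) <= abs (c ^+ 2 ^+ 2).
      rewrite -(ler_pM2r q0) h; apply: ler_wpM2l => //; exact: padic_abs_ge0.
    by rewrite !absX ler_sqr ?nnegrE ?exprn_ge0 ?padic_abs_ge0.
  have : dilate c M (c *: u) by exists u.
  rewrite -hT => -[w1 M1 h1]; have : dilate c M (c *: w1) by exists w1.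
  rewrite -hT => -[w2 M2 h2]; have := Mle _ M2; rewrite /ball /= => hw2.
  have : sqrt_mx v *m (sqrt_mx v *m w2) = c ^+ 2 *: u.
    by rewrite h2 -scalemxAr h1 scalerA expr2.
  rewrite sqrt_mx_sqr => /(congr1 (fun x => abs (qf v x))).
  rewrite !qf_scale sqrrN 2!padic_absM => h.
  have : abs (c ^+ 2 ^+ 2) <= abs (Qform v ^+ 2).
    rewrite -(ler_pM2r q0) -h; apply: ler_wpM2l => //; exact: padic_abs_ge0.
  by rewrite !absX ler_sqr ?nnegrE ?exprn_ge0 ?padic_abs_ge0.
have ce1 : abs (e * c) = 1.
  apply/eqP; rewrite -(@sqrp_eq1 _ (abs _)) ?padic_abs_ge0 // -absX exprMn.
  rewrite padic_absM cQ -padic_absM.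
  exact/eqP.
have Mg : M (e *: (sqrt_mx v *m u)).
  have : mximg (sqrt_mx v) M (sqrt_mx v *m u) by exists u.
  rewrite hT => -[w Mw <-]; rewrite scalerA -[_ *: w]addr0 -(scale0r w).
  by apply: lattice_comb => //; rewrite ?ZpE ?ce1 //; exact: Zp0.
have -> : M = ball v (abs (qf v u)).
  apply/seteqP; split=> //; rewrite (ball_span hv u0 he) => _ [a ha [b hb <-]].
  exact: lattice_comb.
exact: proj_ball_val.
Qed.

(** * Distances in the tree *)

Lemma Zp_span_swap u w : Zp_span u w = Zp_span w u.
Proof. by apply/seteqP; split; apply: Zp_span_sub; (exact: Zp_spanl || exact: Zp_spanr). Qed.

Lemma Zp_spanZ u w s a : Zp_span u w s -> Zp a -> Zp_span u w (a *: s).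
Proof.
move=> hs ha; rewrite -[_ *: _]addr0 -(scale0r s); apply: Zp_span_comb => //; exact: Zp0.
Qed.

Lemma Zp_span_unit u w a : abs a = 1 -> Zp_span u (a *: w) = Zp_span u w.
Proof.
move=> a1; have a0 : a != 0 by rewrite -abs_gt0 a1 ltr01.
apply/seteqP; split; apply: Zp_span_sub; try exact: Zp_spanl.
  by apply: Zp_spanZ; [exact: Zp_spanr|rewrite ZpE a1].
have wE : w = a^-1 *: (a *: w) by rewrite scalerA mulVf // scale1r.
rewrite [X in _ X]wE.
by apply: Zp_spanZ; [exact: Zp_spanr|rewrite ZpE absV a1 invr1].
Qed.

Lemma abs_val_nat x : x != 0 -> abs x <= 1 ->
  exists2 n : nat, abs x = P ^- n & abs (x / p%:R ^+ n) = 1.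
Proof.
move=> x0 x1; have [m hm] := abs_val x0.
have [n nE] : exists n : nat, m = - n%:Z.
  move: x1; rewrite hm; case: m {hm} => [[|n]|n] h; first by exists 0%N.
    by move: h; rewrite -exprnP leNgt exprn_egt1 ?P_gt1.
  by exists n.+1; rewrite NegzE.
have xE : abs x = P ^- n by rewrite hm nE exprnN.
exists n => //; rewrite padic_absM absV absX abs_p exprVn -xE divff // abs_eq0 //.
Qed.

Definition have_adapted_basis L M := exists e1 e2 c n,
  [/\ det2 e1 e2 != 0, c != 0, L = Zp_span e1 e2 &
      dilate c M = Zp_span e1 (p%:R ^+ n *: e2)].

(** One step of elimination, with the coefficient [a] of largest absolute value
    as pivot. *)
Lemma adapted_basis_max u w a b a' b' : det2 u w != 0 ->
  det2 (a *: u + b *: w) (a' *: u + b' *: w) != 0 ->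
  abs b <= abs a -> abs a' <= abs a -> abs b' <= abs a ->
  have_adapted_basis (Zp_span u w) (Zp_span (a *: u + b *: w) (a' *: u + b' *: w)).
Proof.
move=> d0 dm0 ba a'a b'a.
have a0 : a != 0.
  apply: contra_neq dm0 => a0; have b0 : b = 0.
    by apply/eqP; rewrite -abs_eq0 eq_le padic_abs_ge0 andbT -abs0 -a0.
  by rewrite det2_comb a0 b0 !mul0r subrr mul0r.
have div x : abs x <= abs a -> Zp (a^-1 * x).
  by move=> h; rewrite ZpE padic_absM absV mulrC ler_pdivrMr ?abs_gt0 // mul1r.
set m1 := a *: u + b *: w in dm0 *; set m2 := a' *: u + b' *: w in dm0 *.
have hb := div _ ba; have ha' := div _ a'a; have hb' := div _ b'a.
set e1 := a^-1 *: m1.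
have e1E : e1 = 1 *: u + (a^-1 * b) *: w.
  by apply: vecP; rewrite /e1 /m1 !vecE; field.
have ue : u = 1 *: e1 + (- (a^-1 * b)) *: w by rewrite e1E; apply: vecP; rewrite !vecE; ring.
have span1 : Zp_span u w = Zp_span e1 w.
  apply/seteqP; split; apply: Zp_span_sub; try exact: Zp_spanr.
    rewrite [X in _ X]ue; apply: Zp_span_comb; rewrite ?ZpE ?absN ?abs1 //.
      exact: Zp_spanl.
    exact: Zp_spanr.
  rewrite e1E; apply: Zp_span_comb; rewrite ?ZpE ?abs1 //; [exact: Zp_spanl|exact: Zp_spanr].
pose d := a^-1 * b' - a^-1 * a' * (a^-1 * b).
have m2E : a^-1 *: m2 = (a^-1 * a') *: e1 + 1 *: (d *: w).
  by rewrite e1E; apply: vecP; rewrite /m2 /d !vecE; ring.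
have dE : d *: w = (- (a^-1 * a')) *: e1 + 1 *: (a^-1 *: m2).
  by rewrite m2E; apply: vecP; rewrite !vecE; ring.
have span2 : Zp_span e1 (a^-1 *: m2) = Zp_span e1 (d *: w).
  apply/seteqP; split; apply: Zp_span_sub; try exact: Zp_spanl.
    rewrite m2E; apply: Zp_span_comb; rewrite ?ZpE ?abs1 //; [exact: Zp_spanl|exact: Zp_spanr].
  rewrite dE; apply: Zp_span_comb; rewrite ?ZpE ?absN ?abs1 //; first exact: Zp_spanl.
  exact: Zp_spanr.
have dd0 : d != 0.
  apply: contra_neq dm0 => dd0; move: m2E; rewrite dd0 scale0r scaler0 addr0 => m2E.
  have : det2 (a^-1 *: m1) (a^-1 *: m2) = 0.
    by rewrite m2E det2Zr -/e1 /det2 [e1 0 0 * _]mulrC subrr mulr0.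
  by rewrite det2Zl det2Zr => /eqP; rewrite !mulf_eq0 invr_eq0 (negbTE a0) /= => /eqP.
have d1 : abs d <= 1.
  apply: absB_le => //; rewrite padic_absM mulr_ile1 ?padic_abs_ge0 //.
have [n _ hn] := abs_val_nat dd0 d1.
have pn0 : p%:R ^+ n != 0 :> K by rewrite expf_neq0 // p_neq0.
exists e1, w, a^-1, n; split => //.
- by have -> : det2 e1 w = det2 u w by rewrite e1E /det2 !vecE; ring.
- by rewrite invr_eq0.
- rewrite dilate_span -/e1 span2 -{1}(divfK pn0 d) -scalerA; exact: Zp_span_unit.
Qed.

(** Elementary divisors: permuting both bases brings the largest coefficient to
    the position of the pivot. *)
Lemma adapted_basis L M : is_lattice L -> is_lattice M -> have_adapted_basis L M.
Proof.
move=> /latticeP[u [w [d0 ->]]] /latticeP[m1 [m2 [dm0 ->]]].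
have [a [b E1]] := basis2 m1 d0; have [a' [b' E2]] := basis2 m2 d0.
have E1' : m1 = b *: w + a *: u by rewrite addrC.
have E2' : m2 = b' *: w + a' *: u by rewrite addrC.
have dwu : det2 w u != 0 by rewrite det2_neq0C.
have dm21 : det2 m2 m1 != 0 by rewrite det2_neq0C.
have A : abs b <= abs a -> abs a' <= abs a -> abs b' <= abs a ->
    have_adapted_basis (Zp_span u w) (Zp_span m1 m2).
  by rewrite E1 E2; apply: adapted_basis_max; rewrite -?E1 -?E2.
have B : abs a <= abs b -> abs a' <= abs b -> abs b' <= abs b ->
    have_adapted_basis (Zp_span u w) (Zp_span m1 m2).
  by rewrite E1' E2' (Zp_span_swap u) => ? ? ?; apply: adapted_basis_max; rewrite -?E1' -?E2'.
have C : abs a <= abs a' -> abs b <= abs a' -> abs b' <= abs a' ->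
    have_adapted_basis (Zp_span u w) (Zp_span m1 m2).
  by rewrite (Zp_span_swap m1) E1 E2 => ? ? ?; apply: adapted_basis_max; rewrite -?E1 -?E2.
have D : abs a <= abs b' -> abs b <= abs b' -> abs a' <= abs b' ->
    have_adapted_basis (Zp_span u w) (Zp_span m1 m2).
  rewrite (Zp_span_swap m1) (Zp_span_swap u) E1' E2' => ? ? ?.
  by apply: adapted_basis_max; rewrite -?E1' -?E2'.
have := le_total (abs a) (abs b); have := le_total (abs a') (abs b').
move=> /orP[h1|h1] /orP[h2|h2].
- by have /orP[h|h] := le_total (abs b) (abs b'); [apply: D|apply: B] => //;
    first [exact: le_trans h1 h|exact: le_trans h2 h].
- by have /orP[h|h] := le_total (abs a) (abs b'); [apply: D|apply: A] => //;
    first [exact: le_trans h1 h|exact: le_trans h2 h].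
- by have /orP[h|h] := le_total (abs b) (abs a'); [apply: C|apply: B] => //;
    first [exact: le_trans h1 h|exact: le_trans h2 h].
- by have /orP[h|h] := le_total (abs a) (abs a'); [apply: C|apply: A] => //;
    first [exact: le_trans h1 h|exact: le_trans h2 h].
Qed.

Lemma lattice_dilate c L : c != 0 -> is_lattice L -> is_lattice (dilate c L).
Proof.
move=> c0 /latticeP[u [w [d0 ->]]]; rewrite dilate_span; apply: lattice_span.
by rewrite det2Zl det2Zr !mulf_neq0.
Qed.

Lemma lattice_sub L u w : is_lattice L -> L u -> L w -> L (u - w).
Proof.
move=> hL hu hw; rewrite -[u]scale1r -scaleN1r; apply: lattice_comb => //.
  exact: Zp1.
by rewrite ZpE absN abs1.
Qed.

Lemma latticeZ L u a : is_lattice L -> L u -> Zp a -> L (a *: u).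
Proof. by move=> /latticeP[s [t [_ ->]]]; exact: Zp_spanZ. Qed.

Lemma lattice0 L : is_lattice L -> L 0.
Proof.
move=> /latticeP[s [t [_ ->]]]; rewrite -(scale0r s).
by apply: Zp_spanZ; [exact: Zp_spanl|exact: Zp0].
Qed.

Lemma lattice_add L u w : is_lattice L -> L u -> L w -> L (u + w).
Proof.
move=> hL hu hw; rewrite -[u]scale1r -[w]scale1r; apply: lattice_comb => //; exact: Zp1.
Qed.

Lemma coset_eq M u w : is_lattice M ->
  [set u + x | x in M] = [set w + x | x in M] <-> M (u - w).
Proof.
move=> hM; split=> [h|h].
  have : [set u + x | x in M] (u + 0) by exists 0 => //; exact: lattice0.
  by rewrite addr0 h => -[x Mx <-]; rewrite addrC addKr.
apply/seteqP; split=> _ [x Mx <-].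
  by exists (u - w + x); [exact: lattice_add|rewrite addrA [w + _]addrC subrK].
exists (x - (u - w)); first exact: lattice_sub.
by rewrite opprB addrCA [u + _]addrC subrK addrC.
Qed.

Lemma abs_lt1 a : abs a < 1 -> abs a <= P^-1.
Proof.
have [->|a0] := eqVneq a 0; first by rewrite abs0 invr_ge0 ltW // P_gt0.
move=> h; have [[|n] hn _] := abs_val_nat a0 (ltW h).
  by move: h; rewrite hn expr0 invr1 ltxx.
rewrite hn lef_pV2 ?posrE ?exprn_gt0 ?P_gt0 // exprS ler_peMr ?(ltW P_gt0) //.
by rewrite exprn_ege1 // ltW // P_gt1.
Qed.

Lemma residue_lt a : Zp a -> exists2 j : nat, (j < p)%N & abs (a - j%:R) < 1.
Proof.
rewrite ZpE => /residue[n hn]; exists (n %% p)%N; first by rewrite ltn_mod prime_gt0.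
rewrite -[a](subrK n%:R) -addrA; apply: absD_lt => //.
rewrite {1}(divn_eq n p) natrD addrK natrM padic_absM abs_p.
rewrite ltr_pdivrMr ?P_gt0 // mul1r; apply: le_lt_trans P_gt1.
by rewrite [_%:R]pmulrn; exact: abs_int_le1.
Qed.

Lemma abs_sub_nat (i j : nat) : (i < p)%N -> (j < p)%N -> abs (i%:R - j%:R) < 1 -> i = j.
Proof.
wlog ij : i j / (i <= j)%N => [H|] ip jp h.
  have /orP[ij|ij] := leq_total i j; first exact: H.
  by apply/esym/H => //; rewrite absBC.
apply/eqP; rewrite eqn_leq ij leqNgt; apply/negP => lt.
move: h; rewrite absBC -natrB // abs_nat_coprime ?ltxx // gtnNdvd ?subn_gt0 //.
exact: leq_ltn_trans (leq_subr _ _) jp.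
Qed.

(** The cosets are represented by the multiples [j w], for [j < p]. *)
Lemma has_index_span u w : det2 u w != 0 ->
  has_index (Zp_span u w) (Zp_span u (p%:R *: w)) p.
Proof.
move=> d0; have Zpp : Zp p%:R by rewrite ZpE [_%:R]pmulrn abs_int_le1.
have dp : det2 u (p%:R *: w) != 0 by rewrite det2Zr mulf_neq0 // p_neq0.
have hM := lattice_span dp; set M := Zp_span u _ in hM *.
have memM a b : M (a *: u + b *: w) <-> Zp a /\ abs b < 1.
  have -> : a *: u + b *: w = a *: u + (b / p%:R) *: (p%:R *: w).
    by rewrite scalerA divfK // p_neq0.
  have bE : Zp (b / p%:R) <-> abs b < 1.
    rewrite ZpE padic_absM absV abs_p invrK -ler_pdivlMr ?P_gt0 // mul1r.
    split; last exact: abs_lt1.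
    by move=> h; apply: le_lt_trans h _; rewrite invf_lt1 ?P_gt0 ?P_gt1.
  by split=> [/(Zp_spanP _ _ dp)[h1 /bE h2]|[h1 /bE h2]] //; apply/(Zp_spanP _ _ dp).
split.
  by apply: Zp_span_sub; [exact: Zp_spanl|apply: Zp_spanZ => //; exact: Zp_spanr].
pose F (j : nat) := [set j%:R *: w + m | m in M].
have -> : [set [set x + m | m in M] | x in Zp_span u w] = F @` `I_p.
  apply/seteqP; split=> X.
    move=> [_ [a ha [b hb <-]] <-]; have [j jp hj] := residue_lt hb.
    exists j => //; apply/coset_eq => //.
    have -> : j%:R *: w - (a *: u + b *: w) = (- a) *: u + (j%:R - b) *: w.
      by apply: vecP; rewrite !vecE; ring.
    by apply/memM; rewrite ZpE absN absBC.
  move=> [j jp <-]; exists (j%:R *: w) => //.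
  apply: Zp_spanZ; first exact: Zp_spanr.
  by rewrite ZpE [_%:R]pmulrn abs_int_le1.
apply: inj_card_eq => i j /set_mem/= ip /set_mem/= jp /coset_eq => /(_ hM).
rewrite -scalerBl -[_ *: w]add0r -(scale0r u) => /memM[_]; exact: abs_sub_nat.
Qed.

(** Two of the multiples [i l], for [i <= p], lie in the same coset, so that
    some [k l] with [0 < k <= p] belongs to [M], and [k] divides [p] among the
    integers of the field. *)
Lemma has_index_incl L M : is_lattice L -> is_lattice M -> has_index L M p ->
  dilate p%:R L `<=` M.
Proof.
move=> hL hM [ML card] _ [l Ll <-].
pose F (j : nat) := [set j%:R *: l + m | m in M].
have Zpn (j : nat) : Zp j%:R by rewrite ZpE [_%:R]pmulrn abs_int_le1.
have [i [j [ij jp Fij]]] : exists i j, [/\ (i < j)%N, (j <= p)%N & F i = F j].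
  apply: contrapT => H; have inj : {in `I_p.+1 &, injective F}.
    move=> i j /set_mem/= ip /set_mem/= jp Fij; apply: contrapT => /eqP.
    rewrite neq_ltn => /orP[ij|ij]; apply: H; first by exists i, j.
    by exists j, i.
  have : (`I_p.+1 #<= `I_p)%card.
    rewrite -(card_le_eql (inj_card_eq inj)) -(card_le_eqr card).
    apply: subset_card_le => _ [j _ <-]; exists (j%:R *: l) => //; exact: latticeZ.
  by rewrite card_le_II ltnn.
have Ml : M ((j - i)%N%:R *: l).
  rewrite natrB ?(ltnW ij) // scalerBl; exact/coset_eq.
have [jip|jip] := ltnP (j - i) p; last first.
  have jiE : (j - i)%N = p by apply/eqP; rewrite eqn_leq jip (leq_trans (leq_subr _ _)).
  by move: Ml; rewrite jiE.
have h1 : abs (j - i)%N%:R = 1 by apply: abs_nat_coprime; rewrite gtnNdvd // subn_gt0.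
have h0 : (j - i)%N%:R != 0 :> K by rewrite -abs_gt0 h1 ltr01.
rewrite -[p%:R](mulfVK h0) -scalerA; apply: latticeZ => //.
by rewrite ZpE padic_absM absV h1 divr1; exact: Zpn.
Qed.

Lemma tree_lattice (X : set (set vec)) L : tree K X -> X L ->
  is_lattice L /\ X = homothety_class L.
Proof.
move=> [L0 hL0 ->] [c c0 <-]; split; first exact: lattice_dilate.
exact/esym/class_dilate.
Qed.

Lemma dilateS c L M : L `<=` M -> dilate c L `<=` dilate c M.
Proof. by move=> LM _ [u hu <-]; exists u => //; exact: LM. Qed.

(** The bound [n] on the distance of two homothety classes, expressed without
    paths. *)
Definition within (n : nat) L M := exists c,
  [/\ c != 0, dilate (p%:R ^+ n) L `<=` dilate c M & dilate c M `<=` L].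

Lemma withinZ n L M a b : a != 0 -> b != 0 -> within n L M ->
  within n (dilate a L) (dilate b M).
Proof.
move=> a0 b0 [c [c0 h1 h2]]; exists (a * c / b); split; first by rewrite !mulf_neq0 ?invr_eq0.
  by rewrite !dilateM divfK // mulrC -!dilateM; exact: dilateS.
by rewrite !dilateM divfK // -!dilateM; exact: dilateS.
Qed.

Lemma within_trans m n L M N : within m L M -> within n M N -> within (m + n) L N.
Proof.
move=> [c [c0 h1 h2]] [d [d0 k1 k2]]; exists (c * d); split; first exact: mulf_neq0.
  have s1 := @dilateS (p%:R ^+ n) _ _ h1; have s2 := @dilateS c _ _ k1.
  move: s1 s2; rewrite !dilateM -exprD addnC [_ * c]mulrC; exact: subset_trans.
by move: (@dilateS c _ _ k2); rewrite dilateM => s2; exact: subset_trans s2 h2.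
Qed.

Lemma adjacent_within (X Y : set (set vec)) L M :
  Defs.adjacent X Y -> X L -> Y M -> within 1 L M.
Proof.
move=> [tX tY [L1 [M1 [XL1 YM1 idx]]]] XL YM.
have [hL1 XE] := tree_lattice tX XL1; have [hM1 YE] := tree_lattice tY YM1.
move: XL YM; rewrite XE YE => -[a a0 <-] [b b0 <-]; apply: withinZ => //.
case: idx => idx.
  exists 1; rewrite oner_neq0 dilate1 expr1; split => //; last exact: idx.1.
  exact: has_index_incl.
exists p%:R; rewrite p_neq0 expr1; split => //; last exact: has_index_incl.
exact: dilateS idx.1.
Qed.

Lemma walk_within (X Y : set (set vec)) L M n : tree K X ->
  walk X Y n -> X L -> Y M -> within n L M.
Proof.
move=> tX [f [f0 fn fadj]] XL YM; rewrite -fn in YM.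
elim: n M fadj YM {fn Y} => [|n IH] M fadj YM.
  move: YM; rewrite f0 (tree_lattice tX XL).2 => -[c c0 <-].
  exists c^-1; rewrite dilateK // expr0 dilate1; split=> //; by rewrite invr_eq0.
have adj := fadj n (ltnSn n); have [tN _ _] := adj.
have [N hN fN] := tN.
have fNN : f n N by rewrite fN; exact: mem_class.
rewrite -addn1; apply: (@within_trans _ _ _ N).
  by apply: IH => // i hi; apply: fadj; exact: ltn_trans hi _.
exact: adjacent_within adj fNN YM.
Qed.

Lemma within_span u w n m : det2 u w != 0 ->
  within m (Zp_span u w) (Zp_span u (p%:R ^+ n *: w)) -> (n <= m)%N.
Proof.
move=> d0 [c [c0 h1 h2]].
have pn0 : p%:R ^+ n != 0 :> K by rewrite expf_neq0 // p_neq0.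
have c1 : abs c <= 1.
  have /h2 : dilate c (Zp_span u (p%:R ^+ n *: w)) (c *: u) by exists u => //; exact: Zp_spanl.
  by rewrite -[_ *: u]addr0 -(scale0r w) => /(Zp_spanP _ _ d0)[].
have /h1 : dilate (p%:R ^+ m) (Zp_span u w) (p%:R ^+ m *: w).
  by exists w => //; exact: Zp_spanr.
rewrite dilate_span scalerA.
have dc : det2 (c *: u) ((c * p%:R ^+ n) *: w) != 0 by rewrite det2Zl det2Zr !mulf_neq0.
have -> : p%:R ^+ m *: w = 0 *: (c *: u) +
    (p%:R ^+ m / (c * p%:R ^+ n)) *: ((c * p%:R ^+ n) *: w).
  by rewrite scale0r add0r scalerA divfK // mulf_neq0.
move=> /(Zp_spanP _ _ dc)[_]; rewrite ZpE padic_absM absV padic_absM !absX abs_p !exprVn.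
have Pn (k : nat) : 0 < P ^+ k by rewrite exprn_gt0 // P_gt0.
rewrite ler_pdivrMr ?mul1r; last by rewrite mulr_gt0 ?invr_gt0 // abs_gt0.
move=> h; rewrite -(ler_eXn2l (P_gt1)) -lef_pV2 ?posrE //.
by apply: le_trans h _; rewrite ler_piMl // invr_ge0 ltW.
Qed.

Lemma walk_span u w n : det2 u w != 0 ->
  walk (homothety_class (Zp_span u w)) (homothety_class (Zp_span u (p%:R ^+ n *: w))) n.
Proof.
move=> d0; exists (fun i => homothety_class (Zp_span u (p%:R ^+ i *: w))); split=> //.
  by rewrite expr0 scale1r.
move=> i _; have di (k : nat) : det2 u (p%:R ^+ k *: w) != 0.
  by rewrite det2Zr mulf_neq0 // expf_neq0 // p_neq0.
split; [exact/tree_class/lattice_span/di|exact/tree_class/lattice_span/di|].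
exists (Zp_span u (p%:R ^+ i *: w)), (Zp_span u (p%:R ^+ i.+1 *: w)).
split; [exact: mem_class|exact: mem_class|left].
rewrite exprS -scalerA; exact: has_index_span.
Qed.

Lemma tree_dist_span u w n : det2 u w != 0 ->
  tree_dist K (homothety_class (Zp_span u w))
    (homothety_class (Zp_span u (p%:R ^+ n *: w))) = (n%:R)%:E.
Proof.
move=> d0; apply/le_anti/andP; split.
  apply: ge_ereal_inf; exists (n%:R)%:E => //; exists n => //; exact: walk_span.
apply/ereal_infP => _ [m /walk_within hm <-]; rewrite lee_fin ler_nat.
apply: (within_span d0); apply: hm; [|exact: mem_class|exact: mem_class].
exact/tree_class/lattice_span.
Qed.

(** * The cross ratios *)

Variable alpha : K.
Hypothesis KE : Kgroup alpha = ev.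
Local Notation dual := 'Hom(form, (K : fieldType)^o).
Local Notation cls := (scale_class ev).

Lemma discE : disc alpha = [set cls v | v in even_form].
Proof. by rewrite /disc KE HsetE. Qed.

Lemma mem_cls (V : lmodType K) (x : V) : cls x x.
Proof. exists 1; [exact: ev1|exact: scale1r]. Qed.

Lemma cls_scale (V : lmodType K) k (x : V) : ev k -> cls (k *: x) = cls x.
Proof.
move=> ek; have k0 := ev_neq0 ek; apply/seteqP; split=> _ [c ec <-].
  by exists (c * k); [exact: evM|rewrite scalerA].
by exists (c / k); [apply: evM => //; exact: evV|rewrite scalerA divfK].
Qed.

Definition even_functional (phi : dual) := forall v, even_form v -> ev (phi v).

(** Were [phi v'] too large compared with [phi v], then [phi] would vanish at
    a small perturbation [v + l v'] of [v], which still lies in [even_form]. *)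
Lemma even_functional_bound phi v v' (C : R) : even_functional phi ->
  even_form v -> even_form v' -> 0 <= C ->
  (forall u, abs (qf v' u) <= C * abs (qf v u)) -> abs (phi v') <= C * abs (phi v).
Proof.
move=> hphi hv hv' C0 hC; rewrite leNgt; apply/negP => lt.
have v'0 := ev_neq0 (hphi _ hv').
pose l := - (phi v / phi v').
have lC : abs l * C < 1.
  by rewrite absN padic_absM absV mulrAC ltr_pdivrMr ?abs_gt0 // mul1r mulrC.
have : even_form (v + l *: v').
  move=> u u0; apply: ev_abs (hv u u0); rewrite qfD qfZ absD_dom // padic_absM.
  have q0 : 0 < abs (qf v u) by rewrite abs_gt0 even_form_neq0.
  apply: (@le_lt_trans _ _ (abs l * (C * abs (qf v u)))).
    by apply: ler_wpM2l => //; exact: padic_abs_ge0.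
  by rewrite mulrA -[X in _ < X]mul1r ltr_pM2r.
move=> /hphi/ev_neq0/negP; apply; apply/eqP.
rewrite linearD linearZ /= /l scaleNr; apply/eqP; rewrite subr_eq0; apply/eqP.
by rewrite -[_ *: _]/(_ * _) divfK.
Qed.

Definition eval_qf u (v : form) : (K : fieldType)^o := qf v u.

Lemma eval_qf_linear u : linear (eval_qf u).
Proof. by move=> a v w; rewrite /eval_qf qfD qfZ. Qed.

HB.instance Definition _ u := GRing.isLinear.Build K form ((K : fieldType)^o) _
  (eval_qf u) (eval_qf_linear u).

Definition evalf u : dual := linfun (eval_qf u).

Lemma evalfE u v : evalf u v = qf v u.
Proof. by rewrite lfunE. Qed.

Lemma even_functional_evalf u : u != 0 -> even_functional (evalf u).
Proof. by move=> u0 v hv; rewrite evalfE; exact: hv. Qed.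

Lemma dual_disc_even_functional (F : set dual) phi :
  dual_disc alpha F -> F phi -> even_functional phi.
Proof.
move=> [_ h] Fphi v hv; rewrite -KE; apply: (h (cls v)) => //; last exact: mem_cls.
by rewrite discE; exists v.
Qed.

Lemma even_functional_dual_disc v phi : even_form v -> even_functional phi ->
  dual_disc alpha (cls phi).
Proof.
move=> hv hphi; split.
  exists phi; last by rewrite KE.
  by apply: contraTneq (ev_neq0 (hphi _ hv)) => ->; rewrite zero_lfunE eqxx.
move=> x; rewrite discE KE => -[w hw <-] _ _ [k ek <-] [l el <-].
rewrite scale_lfunE linearZ /=; apply: evM => //; apply: evM => //; exact: hphi.
Qed.

(** Both sides are squares of norms with values in the value group, so they are
    determined by their unit balls. *)
Lemma qf_ball_span v e1 e2 a b : even_form v -> det2 e1 e2 != 0 ->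
  ball v 1 = Zp_span e1 e2 ->
  abs (qf v (a *: e1 + b *: e2)) = Num.max (abs a ^+ 2) (abs b ^+ 2).
Proof.
move=> hv d0 bE; set t := a *: e1 + b *: e2.
have scale c : c^-1 *: t = (c^-1 * a) *: e1 + (c^-1 * b) *: e2.
  by rewrite scalerDr !scalerA.
have div c (x : K) : c != 0 -> Zp (c^-1 * x) <-> abs x ^+ 2 <= abs c ^+ 2.
  move=> c0; rewrite ZpE padic_absM absV mulrC ler_pdivrMr ?abs_gt0 // mul1r.
  by rewrite ler_sqr ?nnegrE ?padic_abs_ge0.
have key c : c != 0 -> abs (qf v t) <= abs c ^+ 2 <->
    abs a ^+ 2 <= abs c ^+ 2 /\ abs b ^+ 2 <= abs c ^+ 2.
  move=> c0; have c2 : 0 < abs c ^+ 2 by rewrite exprn_gt0 // abs_gt0.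
  have -> : (abs (qf v t) <= abs c ^+ 2) = (abs (qf v (c^-1 *: t)) <= 1).
    by rewrite qf_scale padic_absM absX absV exprVn mulrC ler_pdivrMr // mul1r.
  rewrite -[X in X <-> _]/(ball v 1 (c^-1 *: t)) bE scale; split.
    by move=> /(Zp_spanP _ _ d0)[/(div _ _ c0) ha /(div _ _ c0) hb].
  by move=> [/(div _ _ c0) ha /(div _ _ c0) hb]; apply/(Zp_spanP _ _ d0).
have [h|t0] := eqVneq t 0.
  have [-> ->] : a = 0 /\ b = 0 by apply: (basis2_inj d0); rewrite -/t h !scale0r addr0.
  by rewrite h qf0 abs0 expr0n maxxx.
apply/le_anti/andP; split; last first.
  have [c c0 hc] := ev_abs_sqr (hv t t0).
  by rewrite hc ge_max; apply/andP/(key _ c0); rewrite hc.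
have [ab|ab] := lerP (abs a ^+ 2) (abs b ^+ 2).
  apply/key => //; apply: contra_neq t0 => b0; move: ab; rewrite b0 abs0 expr0n /=.
  rewrite -absX => a0; have /eqP : abs (a ^+ 2) = 0.
    by apply/eqP; rewrite eq_le a0 padic_abs_ge0.
  by rewrite abs_eq0 sqrf_eq0 => /eqP a00; rewrite /t b0 a00 !scale0r addr0.
apply/key; last by split=> //; exact: ltW.
by apply: contraTneq ab => ->; rewrite abs0 expr0n -leNgt exprn_ge0 ?padic_abs_ge0.
Qed.

(** The homothety in the elementary divisor theorem is absorbed by a change of
    representative of the second point. *)
Lemma adapted_forms v v' : even_form v -> even_form v' -> exists (w : form) e1 e2 n,
  [/\ even_form w, cls w = cls v', det2 e1 e2 != 0 & ball v 1 = Zp_span e1 e2 /\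
   ball w 1 = Zp_span e1 (p%:R ^+ n *: e2)].
Proof.
move=> hv hv'.
have lat (w : form) : even_form w -> is_lattice (ball w 1).
  move=> hw; have [M hM h] := proj_tree hw.
  have [c c0 ->] := class_eq (esym h); exact: lattice_dilate.
have [e1 [e2 [c [n [d0 c0 E1 E2]]]]] := adapted_basis (lat _ hv) (lat _ hv').
have ec : ev (c ^- 2) by apply: evV; exact: ev_sqr.
exists (c ^- 2 *: v'), e1, e2, n; split => //; first exact: even_formZ.
  exact: cls_scale.
split => //; rewrite -E2 dilate_ball // mulr1 -(ball_scale v' _ (ev_neq0 ec)).
by rewrite absV absX mulVf // expf_neq0 // abs_eq0.
Qed.

Section Pair.
Variables (v w : form) (e1 e2 : vec) (n : nat).
Hypotheses (hv : even_form v) (hw : even_form w) (d0 : det2 e1 e2 != 0).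
Hypotheses (bv : ball v 1 = Zp_span e1 e2).
Hypotheses (bw : ball w 1 = Zp_span e1 (p%:R ^+ n *: e2)).
Local Notation N := (P ^+ n ^+ 2).

Lemma N_ge1 : 1 <= N.
Proof. by rewrite !exprn_ege1 // ltW // P_gt1. Qed.

Lemma N_gt0 : 0 < N.
Proof. exact: lt_le_trans ltr01 N_ge1. Qed.

Lemma pn_neq0 : p%:R ^+ n != 0 :> K.
Proof. by rewrite expf_neq0 // p_neq0. Qed.

Lemma abs_qf_v a b : abs (qf v (a *: e1 + b *: e2)) = Num.max (abs a ^+ 2) (abs b ^+ 2).
Proof. exact: qf_ball_span. Qed.

Lemma abs_qf_w a b :
  abs (qf w (a *: e1 + b *: e2)) = Num.max (abs a ^+ 2) (N * abs b ^+ 2).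
Proof.
have d1 : det2 e1 (p%:R ^+ n *: e2) != 0 by rewrite det2Zr mulf_neq0 // pn_neq0.
have -> : b *: e2 = (b / p%:R ^+ n) *: (p%:R ^+ n *: e2) by rewrite scalerA divfK // pn_neq0.
rewrite (qf_ball_span _ _ hw d1 bw) padic_absM absV absX abs_p exprVn invrK exprMn.
by rewrite [_ * N]mulrC.
Qed.

Lemma qf_vw u : abs (qf v u) <= abs (qf w u) <= N * abs (qf v u).
Proof.
have [a [b ->]] := basis2 u d0; rewrite abs_qf_v abs_qf_w.
have b2 : 0 <= abs b ^+ 2 by rewrite exprn_ge0 ?padic_abs_ge0.
have a2 : 0 <= abs a ^+ 2 by rewrite exprn_ge0 ?padic_abs_ge0.
apply/andP; split.
  rewrite ge_max !le_max lexx /=; apply/orP; right.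
  by rewrite ler_peMl // N_ge1.
rewrite maxr_pMr ?(ltW N_gt0) // ge_max !le_max lexx orbT andbT.
by rewrite ler_peMl ?N_ge1.
Qed.

Lemma even_functional_v_le phi : even_functional phi -> abs (phi v) <= abs (phi w).
Proof.
move=> h; rewrite -[X in _ <= X]mul1r; apply: even_functional_bound => // u.
by rewrite mul1r; have /andP[] := qf_vw u.
Qed.

Lemma even_functional_w_le phi : even_functional phi -> abs (phi w) <= N * abs (phi v).
Proof.
by move=> h; apply: even_functional_bound => // u; have /andP[] := qf_vw u.
Qed.

Lemma cross_bound (t : K) : cross_ratios alpha (cls v) (cls w) t ->
  [/\ ev t, abs t <= N & abs t^-1 <= N].
Proof.
move=> [F [F' [dF dF' [phi [phi' [_ [_ [Fphi Fphi' [k ek <-] [l el <-] ->]]]]]]]].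
have h := dual_disc_even_functional dF Fphi; have h' := dual_disc_even_functional dF' Fphi'.
have lin (f : dual) c x : f (c *: x) = c * f x :> K by rewrite linearZ.
rewrite !lin.
have [k0 l0] := (ev_neq0 ek, ev_neq0 el).
have [a0 b0] := (ev_neq0 (h _ hv), ev_neq0 (h _ hw)).
have [c0 f0] := (ev_neq0 (h' _ hv), ev_neq0 (h' _ hw)).
have -> : l * phi w / (k * phi v) * (k * phi' v / (l * phi' w)) =
    (phi w / phi v) * (phi' v / phi' w).
  by field; rewrite k0 l0 a0 f0.
have q (x y : K) (C : R) : y != 0 -> abs x <= C * abs y -> abs (x / y) <= C.
  by move=> y0; rewrite padic_absM absV ler_pdivrMr // abs_gt0.
split.
- by apply: evM; apply: evM; try apply: evV; (exact: h || exact: h').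
- rewrite padic_absM -[N]mulr1; apply: ler_pM; rewrite ?padic_abs_ge0 //.
    by apply: q => //; exact: even_functional_w_le.
  by apply: q => //; rewrite mul1r; exact: even_functional_v_le.
- have -> : (phi w / phi v * (phi' v / phi' w))^-1 = (phi' w / phi' v) * (phi v / phi w).
    by field; rewrite a0 b0 c0 f0.
  rewrite padic_absM -[N]mulr1; apply: ler_pM; rewrite ?padic_abs_ge0 //.
    by apply: q => //; exact: even_functional_w_le.
  by apply: q => //; rewrite mul1r; exact: even_functional_v_le.
Qed.

Lemma cross_attained : exists2 t, cross_ratios alpha (cls v) (cls w) t & abs t = N.
Proof.
have e10 := det2_neq0l d0; have e20 := det2_neq0r d0.
have p1 := even_functional_evalf e10; have p2 := even_functional_evalf e20.
exists ((evalf e2 w / evalf e2 v) * (evalf e1 v / evalf e1 w)).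
  exists (cls (evalf e2)), (cls (evalf e1)); split.
  - exact: even_functional_dual_disc hv p2.
  - exact: even_functional_dual_disc hv p1.
  - by exists (evalf e2), (evalf e1), v, w; split => //; exact: mem_cls.
rewrite !evalfE !padic_absM !absV.
have E2 : e2 = 0 *: e1 + 1 *: e2 by rewrite scale0r scale1r add0r.
have E1 : e1 = 1 *: e1 + 0 *: e2 by rewrite scale0r scale1r addr0.
have -> : abs (qf w e2) = N.
  by rewrite E2 abs_qf_w abs0 abs1 expr0n expr1n mulr1 /=; apply/max_idPr/ltW/N_gt0.
have -> : abs (qf v e2) = 1.
  by rewrite E2 abs_qf_v abs0 abs1 expr0n expr1n /=; apply/max_idPr/ler01.
have -> : abs (qf v e1) = 1.
  by rewrite E1 abs_qf_v abs0 abs1 expr0n expr1n /=; apply/max_idPl/ler01.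
have -> : abs (qf w e1) = 1.
  by rewrite E1 abs_qf_w abs0 abs1 expr0n expr1n mulr0 /=; apply/max_idPl/ler01.
by rewrite !invr1 !mulr1.
Qed.

End Pair.

(** * The Hilbert distance *)

Section HaarMeasure.
Variable mu : {measure set (kstar_borel K) -> \bar R}.
Hypothesis haar : is_normalized_haar mu.
Implicit Types (x y : kstar K).

Lemma kstar_open_measurable (U : set (kstar_borel K)) : kstar_open U -> measurable U.
Proof. exact: sub_sigma_algebra. Qed.

Lemma abs_kval_gt0 x : 0 < abs (kval x).
Proof. by rewrite abs_gt0; exact: kval_neq0. Qed.

Definition sphere (m : int) : set (kstar_borel K) := [set x | abs (kval x) = P ^ (2 * m)].

Lemma sphere_measurable m : measurable (sphere m).
Proof.
apply: kstar_open_measurable => x hx; exists (abs (kval x)); first exact: abs_kval_gt0.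
by move=> y; rewrite absBC => /abs_near; rewrite /sphere /= => ->.
Qed.

(** A sphere is a translate of the group of units. *)
Lemma mu_sphere m : mu (sphere m) = 1%E.
Proof.
have [inv norm] := haar.
have u0 : p%:R ^ (- (2 * m)) != 0 :> K by rewrite expfz_neq0 // p_neq0.
rewrite -norm; have <- : sphere 0 = [set x | abs (kval x) = 1].
  by apply/seteqP; split=> x; rewrite /sphere /= mulr0 expr0z.
rewrite -(inv (KStar u0) (sphere 0) (sphere_measurable 0)); congr (mu _).
have au : abs (p%:R ^ (- (2 * m))) = P ^ (2 * m) by rewrite abs_pexpz opprK.
apply/seteqP; split=> x; rewrite /sphere /=.
  move=> hx; have v0 : kval x / p%:R ^ (- (2 * m)) != 0.
    by rewrite mulf_neq0 ?invr_eq0 // kval_neq0.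
  exists (KStar v0); last by apply: val_inj; rewrite /= mulrC divfK.
  by rewrite /= padic_absM absV au hx mulr0 expr0z divff // expfz_neq0 // P_neq0.
by move=> [y hy <-]; rewrite /= padic_absM au hy mulr0 expr0z mulr1.
Qed.

(** The spheres of radii [P ^ (2 (i - n))]: those with [k = 2 n + 1] fill the
    symmetric shell of [shellE]. *)
Definition shell (n k : nat) : set (kstar_borel K) :=
  [set x | exists2 i : nat, (i < k)%N & sphere (i%:Z - n%:Z) x].

Lemma shellS n (k : nat) : shell n k.+1 = shell n k `|` sphere (k%:Z - n%:Z).
Proof.
apply/seteqP; split=> x.
  move=> [i]; rewrite ltnS leq_eqVlt => /orP[/eqP ->|ik] hi; first by right.
  by left; exists i.
by move=> [[i ik hi]|hk]; [exists i => //; exact: ltnW|exists k].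
Qed.

Lemma shell_measurable n (k : nat) : measurable (shell n k).
Proof.
elim: k => [|k IH].
  by rewrite (_ : shell n 0 = set0) //; apply/seteqP; split=> x // [].
rewrite shellS; apply: measurableU => //; exact: sphere_measurable.
Qed.

Lemma mu_shell n (k : nat) : mu (shell n k) = (k%:R)%:E.
Proof.
elim: k => [|k IH].
  by rewrite (_ : shell n 0 = set0) ?measure0 //; apply/seteqP; split=> x // [].
rewrite shellS measureU.
- rewrite -natr1 EFinD; congr (_ + _)%E; [exact: IH|exact: mu_sphere].
- exact: shell_measurable.
- exact: sphere_measurable.
- apply/seteqP; split=> x; last by [].
  move=> [[i ik hi] hk].
  have : P ^ (2 * (i%:Z - n%:Z)) = P ^ (2 * (k%:Z - n%:Z)) by rewrite -hi -hk.
  move=> /(ieexprIz P_gt0 (negbT (gt_eqF P_gt1))) h.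
  have ik_eq : i = k by lia.
  by move: ik; rewrite ik_eq ltnn.
Qed.

Lemma shellE n x : shell n (2 * n).+1 x <->
  [/\ ev (kval x), abs (kval x) <= P ^+ n ^+ 2 & abs (kval x)^-1 <= P ^+ n ^+ 2].
Proof.
have NE : P ^+ n ^+ 2 = P ^ (2 * n%:Z) by rewrite -exprM mulnC exprnP.
rewrite absV NE; split.
  move=> [i hi]; rewrite /sphere /= => hx; rewrite hx invr_expz !ler_eXz2l ?P_gt1 //.
  by split; [exists (i%:Z - n%:Z)|lia|lia].
move=> [[m hm]]; rewrite hm invr_expz !ler_eXz2l ?P_gt1 // => h1 h2.
exists (absz (m + n%:Z)); first by lia.
by rewrite /sphere /= hm; congr (_ ^ (2 * _)); lia.
Qed.

Definition hilbert_ball (A : set K) : set (kstar_borel K) :=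
  [set x | smallest [set symmetric_ball alpha r | r in [set r : R | 0 <= r]] A (kval x)].

(** Symmetric balls are closed, since membership of [t] depends on [|t|] and
    [|t - 1|] only. *)
Lemma hilbert_ball_measurable A : measurable (hilbert_ball A).
Proof.
rewrite -(setCK (hilbert_ball A)); apply: measurableC; apply: kstar_open_measurable => x hx.
have [r [r0 Ar xr]] : exists r, [/\ 0 <= r, A `<=` symmetric_ball alpha r &
    ~ symmetric_ball alpha r (kval x)].
  apply: contrapT => H; apply: hx => B [[r r0 <-] Ar]; apply: contrapT => xr.
  by apply: H; exists r.
have x1 : kval x - 1 != 0.
  rewrite subr_eq0; apply: contra_not_neq xr => ->; split; first by rewrite KE; exact: ev1.
    by rewrite subrr abs0.
  by rewrite invr1 subrr abs0.
exists (Num.min (abs (kval x)) (abs (kval x - 1))).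
  by rewrite lt_min abs_kval_gt0 abs_gt0.
move=> y; rewrite lt_min absBC => /andP[h1 h2] yB; apply: xr.
have [] : symmetric_ball alpha r (kval y) by apply: yB; split => //; exists r.
have E1 : abs (kval y) = abs (kval x) by exact: abs_near h1.
have E2 : abs (kval y - 1) = abs (kval x - 1).
  by apply: abs_near; have -> : kval x - 1 - (kval y - 1) = kval x - kval y by ring.
have inv x' : abs ((kval x')^-1 - 1) = abs (kval x' - 1) / abs (kval x').
  rewrite -absV -padic_absM mulrBl mul1r divff ?kval_neq0 // absBC //.
rewrite KE => ey h3 h4; split; rewrite ?KE.
- exact: ev_abs E1 ey.
- by rewrite -E2.
- by rewrite inv -E1 -E2 -inv.
Qed.

Section PairDistance.
Variables (v w : form) (e1 e2 : vec) (n : nat).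
Hypotheses (hv : even_form v) (hw : even_form w) (d0 : det2 e1 e2 != 0).
Hypotheses (bv : ball v 1 = Zp_span e1 e2).
Hypotheses (bw : ball w 1 = Zp_span e1 (p%:R ^+ n *: e2)).
Local Notation N := (P ^+ n ^+ 2).
Local Notation A := (cross_ratios alpha (cls v) (cls w)).

Lemma abs_sub1_le (t : K) (r : R) : 1 <= r -> (abs (t - 1) <= r) = (abs t <= r).
Proof.
move=> r1; apply/idP/idP => h; last by apply: absB_le; rewrite ?abs1.
by rewrite -[t](subrK 1); apply: absD_le; rewrite ?abs1.
Qed.

Lemma symmetric_ballE (t : K) (r : R) : 1 <= r ->
  symmetric_ball alpha r t <-> [/\ ev t, abs t <= r & abs t^-1 <= r].
Proof.
move=> r1; have e (s : K) : abs (s - 1) <= r <-> abs s <= r by rewrite abs_sub1_le.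
by rewrite /symmetric_ball /= KE; split=> -[? /e ? /e ?].
Qed.

Lemma hilbert_ball_sub : hilbert_ball A `<=` shell n (2 * n).+1.
Proof.
move=> x hx; apply/shellE; apply/symmetric_ballE; first exact: N_ge1.
apply: (hx (symmetric_ball alpha N)); split.
  by exists N => //; apply/ltW/N_gt0.
move=> t ht; apply/symmetric_ballE; first exact: N_ge1.
exact: (cross_bound hv hw d0 bv bw ht).
Qed.

(** A cross ratio of absolute value [N > 1] forces the radius to be at least
    [N]. *)
Lemma hilbert_ball_sup : (0 < n)%N -> shell n (2 * n).+1 `<=` hilbert_ball A.
Proof.
move=> n0 x /shellE/(symmetric_ballE _ (N_ge1 n)) hx B [[r r0 <-] hA].
have [t ht tN] := cross_attained hv hw d0 bv bw.
have N1 : 1 < N by rewrite -exprM exprn_egt1 ?P_gt1 // muln_eq0 negb_or -lt0n n0.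
have rN : N <= r.
  have [_ + _] := hA t ht; apply: le_trans.
  by rewrite absD_dom ?absN ?abs1 tN.
have [h1 h2 h3] := hx; split => //; exact: le_trans rN.
Qed.

Lemma hilbert_dist_le :
  (hilbert_dist alpha mu (cls v) (cls w) <= ((2 * n).+1%:R)%:E)%E.
Proof.
rewrite -(mu_shell n); apply: le_measure; rewrite ?inE.
- exact: hilbert_ball_measurable.
- exact: shell_measurable.
- exact: hilbert_ball_sub.
Qed.

Lemma hilbert_dist_ge : (0 < n)%N ->
  (((2 * n).+1%:R)%:E <= hilbert_dist alpha mu (cls v) (cls w))%E.
Proof.
move=> n0; rewrite -(mu_shell n); apply: le_measure; rewrite ?inE.
- exact: shell_measurable.
- exact: hilbert_ball_measurable.
- exact: hilbert_ball_sup.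
Qed.

Lemma tree_dist_proj : tree_dist K (proj v) (proj w) = (n%:R)%:E.
Proof. by rewrite /proj bv bw tree_dist_span. Qed.

Lemma dist_comparison :
  ((2^-1)%:E * hilbert_dist alpha mu (cls v) (cls w) - 1%:E <= tree_dist K (proj v) (proj w) /\
   tree_dist K (proj v) (proj w) <= 2%:E * hilbert_dist alpha mu (cls v) (cls w) + 1%:E)%E.
Proof.
rewrite tree_dist_proj.
have h0 : (0 <= hilbert_dist alpha mu (cls v) (cls w))%E by exact: measure_ge0.
have h1 := hilbert_dist_le.
have h2 : ((n%:R)%:E <= hilbert_dist alpha mu (cls v) (cls w))%E.
  have [n0|n0] := posnP n; first by rewrite [X in (X%:R)]n0.
  by apply: le_trans (hilbert_dist_ge n0); rewrite lee_fin ler_nat; lia.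
move: h0 h1 h2; case: (hilbert_dist _ _ _ _) => [r| |] //.
rewrite -!EFinM -EFinB -EFinD !lee_fin mulrS natrM => h0 h1 h2.
by split; lra.
Qed.

End PairDistance.
End HaarMeasure.

(** * The projection and its equivariance *)

Implicit Types (e : vec).

Local Notation pgl g := (scale_class (@nonzero K) g).

Lemma cls_eq v (w : form) : cls v = cls w -> exists2 k, ev k & w = k *: v.
Proof. by move=> h; have := mem_cls w; rewrite -h => -[k ek hk]; exists k. Qed.

Lemma disc_act_cls g v : g \in unitmx -> disc_act K (pgl g) (cls v) = cls (gact g v).
Proof.
move=> gu; apply/seteqP; split=> w.
  move=> [_ [c c0 <-] [_ [k ek <-] <-]]; exists (c ^+ 2 * k).
    by apply: evM => //; exact: ev_sqr.
  by rewrite -[RHS]/(gact (c *: g) (k *: v)) gact_scale // gactZ -[LHS]scalerA.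
move=> [k ek <-]; exists g; first by exists 1; [exact: oner_neq0|rewrite scale1r].
by exists (k *: v); [exists k|rewrite -[LHS]/(gact g (k *: v)) gactZ].
Qed.

Lemma stabilizer_proj v : even_form v ->
  stabilizer (disc_act K) (cls v) `<=` stabilizer (tree_act K) (proj v).
Proof.
move=> hv _ [[g gu ->] h]; split; first by exists g.
move: h; rewrite disc_act_cls // => /esym/cls_eq[k ek h].
by rewrite proj_gact // h proj_scale.
Qed.

(** The class of [sqrt_mx v] alone has a single fixed vertex. *)
Lemma stabilizer_unique v (w : set (set vec)) : even_form v -> tree K w ->
  stabilizer (disc_act K) (cls v) `<=` stabilizer (tree_act K) w -> w = proj v.
Proof.
move=> hv [M hM ->] hs; have [eQ _] := even_form_Qform hv.
have Tu : sqrt_mx v \in unitmx by rewrite unitmxE unitfE det_sqrt_mx ev_neq0.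
have /hs[_] : stabilizer (disc_act K) (cls v) (pgl (sqrt_mx v)).
  split; first by exists (sqrt_mx v).
  by rewrite disc_act_cls // gact_sqrt_mx ?ev_neq0 // cls_scale.
rewrite tree_act_class => /esym/class_eq[c c0 h]; apply: fixed_class => //.
by exists c.
Qed.

(** * Long lines and geodesics *)

Variable delta : K.
Hypotheses (delta1 : abs delta = 1) (delta_ns : ~ is_square (- delta)).

Lemma qf_comb_sq u1 u2 (a b s t : K) :
  qf (a *: sq u1 + b *: sq u2) (s *: u1 + t *: u2) =
  det2 u1 u2 ^+ 2 * (b * s ^+ 2 + a * t ^+ 2).
Proof. rewrite qfD !qfZ !qf_sq /det2 !vecE; ring. Qed.

Lemma comb_neq0 e1 e2 (s t : K) : s *: e1 + t *: e2 != 0 -> (s != 0) || (t != 0).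
Proof.
apply: contra_neqT; rewrite negb_or !negbK => /andP[/eqP -> /eqP ->].
by rewrite !scale0r addr0.
Qed.

(** The form [s ^ 2 + delta t ^ 2] in the coordinates of the basis. *)
Lemma diagonal_form e1 e2 : det2 e1 e2 != 0 -> exists a b,
  even_form (a *: sq e1 + b *: sq e2) /\ ball (a *: sq e1 + b *: sq e2) 1 = Zp_span e1 e2.
Proof.
move=> d0; exists (delta / det2 e1 e2 ^+ 2), (1 / det2 e1 e2 ^+ 2).
set v := _ + _; have key (s t : K) : qf v (s *: e1 + t *: e2) = s ^+ 2 + delta * t ^+ 2.
  by rewrite qf_comb_sq; field.
split.
  move=> u; have [s [t ->]] := basis2 u d0 => /comb_neq0 st.
  by rewrite key; apply: ev_norm_form => //; exact: ev_unit.
have bE (s t : K) : ball v 1 (s *: e1 + t *: e2) <-> Zp s /\ Zp t.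
  rewrite /ball /= key abs_norm_form // delta1 mul1r ge_max !expr_le1 ?padic_abs_ge0 //.
  by split; [move=> /andP[]|move=> [hs ht]; apply/andP].
apply/seteqP; split=> u; have [s [t ->]] := basis2 u d0.
  by move=> /bE h; apply/(Zp_spanP _ _ d0).
by move=> /(Zp_spanP _ _ d0)/bE.
Qed.

(** In the coordinates of the basis the form is diagonal, and anisotropic as it
    belongs to the disc. *)
Lemma hyperbolic_ball u1 u2 (a b : K) : det2 u1 u2 != 0 ->
  even_form (a *: sq u1 + b *: sq u2) -> exists x y, [/\ x != 0, y != 0 &
    ball (a *: sq u1 + b *: sq u2) 1 = Zp_span (x *: u1) (y *: u2)].
Proof.
move=> d0; set v := _ + _ => hv; set D2 := det2 u1 u2 ^+ 2.
have key (s t : K) : qf v (s *: u1 + t *: u2) = D2 * b * s ^+ 2 + D2 * a * t ^+ 2.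
  by rewrite qf_comb_sq mulrDr !mulrA.
have eb : ev (D2 * b).
  have -> : D2 * b = qf v (1 *: u1 + 0 *: u2).
    by rewrite key expr1n expr0n /= mulr1 mulr0 addr0.
  by apply: hv; rewrite scale1r scale0r addr0; exact: det2_neq0l d0.
have ea : ev (D2 * a).
  have -> : D2 * a = qf v (0 *: u1 + 1 *: u2).
    by rewrite key expr1n expr0n /= mulr1 mulr0 add0r.
  by apply: hv; rewrite scale1r scale0r add0r; exact: det2_neq0r d0.
have b0 := ev_neq0 eb; have a0 := ev_neq0 ea.
have [x x0 hx] := ev_abs_sqr eb; have [y y0 hy] := ev_abs_sqr ea.
have ns : ~ is_square (- (D2 * a / (D2 * b))).
  move=> [r hr]; have : r *: u1 + 1 *: u2 != 0.
    have : det2 u1 (r *: u1 + 1 *: u2) != 0.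
      by rewrite (_ : det2 _ _ = det2 u1 u2) // /det2 !vecE; ring.
    exact: det2_neq0r.
  move=> /(even_form_neq0 hv)/eqP; apply; rewrite key -hr expr1n mulr1 mulrN mulrC divfK //.
  by rewrite addNr.
exists x^-1, y^-1; rewrite !invr_eq0; split=> //.
have dxy : det2 (x^-1 *: u1) (y^-1 *: u2) != 0 by rewrite det2Zl det2Zr !mulf_neq0 ?invr_eq0.
have bE (s t : K) : ball v 1 (s *: (x^-1 *: u1) + t *: (y^-1 *: u2)) <-> Zp s /\ Zp t.
  rewrite /ball /= !scalerA key.
  have -> : D2 * b * (s / x) ^+ 2 + D2 * a * (t / y) ^+ 2 =
    D2 * b * ((s / x) ^+ 2 + D2 * a / (D2 * b) * (t / y) ^+ 2).
    by rewrite mulrDr; congr (_ + _); rewrite mulrA [D2 * b * (_ / _)]mulrC divfK.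
  rewrite padic_absM abs_norm_form // maxr_pMr ?padic_abs_ge0 //.
  rewrite [_ * (abs (D2 * a / _) * _)]mulrA -[abs (D2 * b) * abs (D2 * a / _)]padic_absM.
  have -> : D2 * b * (D2 * a / (D2 * b)) = D2 * a by rewrite mulrC divfK.
  rewrite hx hy -!exprMn -!padic_absM ![_ * (_ / _)]mulrC !divfK //.
  rewrite ge_max !expr_le1 ?padic_abs_ge0 //.
  by split; [move=> /andP[]|move=> [hs ht]; apply/andP].
apply/seteqP; split=> u; have [s [t ->]] := basis2 u dxy.
  by move=> /bE h; apply/(Zp_spanP _ _ dxy).
by move=> /(Zp_spanP _ _ dxy)/bE.
Qed.

Lemma proj_surj (X : set (set vec)) : tree K X -> exists2 v, even_form v & X = proj v.
Proof.
move=> [L /latticeP[e1 [e2 [d0 ->]]] ->].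
have [a [b [hv bE]]] := diagonal_form d0.
by exists (a *: sq e1 + b *: sq e2) => //; rewrite /proj bE.
Qed.

Definition chord u1 u2 : set (set form) :=
  [set x | exists a b,
     even_form (a *: sq u1 + b *: sq u2) /\ x = cls (a *: sq u1 + b *: sq u2)].

Definition geo u1 u2 : set (set (set vec)) :=
  [set homothety_class (Zp_span (x *: u1) (y *: u2)) | x in @nonzero K & y in @nonzero K].

Lemma geodesicE : geodesic K = [set Gam | exists u1 u2, det2 u1 u2 != 0 /\ Gam = geo u1 u2].
Proof.
apply/seteqP; split=> Gam [u1 [u2]].
  move=> [u10 u20 nc ->]; exists u1, u2; split => //.
  apply/negP => /eqP /(det2_eq0 u10)[c hc]; apply: nc; exists c => //.
  by apply: contra_neq u20 => c0; rewrite hc c0 scale0r.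
move=> [d0 ->]; exists u1, u2; split => //; [exact: det2_neq0l d0|exact: det2_neq0r d0|].
move=> [c c0 h]; move: d0; rewrite h det2Zr /det2 [u1 0 0 * _]mulrC subrr mulr0 eqxx //.
Qed.

Lemma chord_image u1 u2 (pi : set form -> set (set vec)) : det2 u1 u2 != 0 ->
  (forall v, even_form v -> pi (cls v) = proj v) -> pi @` chord u1 u2 = geo u1 u2.
Proof.
move=> d0 piE; apply/seteqP; split=> X.
  move=> [_ [a [b [hv ->]]] <-]; have [x [y [x0 y0 bE]]] := hyperbolic_ball d0 hv.
  by exists x => //; exists y => //; rewrite piE // /proj bE.
move=> [x x0 [y y0 <-]].
have dxy : det2 (x *: u1) (y *: u2) != 0 by rewrite det2Zl det2Zr !mulf_neq0.
have [a [b [hv bE]]] := diagonal_form dxy.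
exists (cls (a *: sq (x *: u1) + b *: sq (y *: u2))); last by rewrite piE // /proj bE.
by exists (a * x ^+ 2), (b * y ^+ 2); move: hv; rewrite !sqZ !scalerA.
Qed.

Lemma Qform_sq u : Qform (sq u) = 0.
Proof. rewrite /Qform /sq !coordE; ring. Qed.

Lemma QformZ c v : Qform (c *: v) = c ^+ 2 * Qform v.
Proof. rewrite /Qform !coordE; ring. Qed.

Lemma Qform_comb_sq v l u : Qform (v + l *: sq u) = Qform v + l * qf v u.
Proof. rewrite /Qform /qf /sq !coordE; ring. Qed.

Lemma isotropicP v : v != 0 -> Qform v = 0 -> exists c u, [/\ c != 0, u != 0 & v = c *: sq u].
Proof.
move=> v0 /eqP; rewrite subr_eq0 => /eqP h.
have [x0|x0] := eqVneq (xcoord v) 0.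
  have y0 : ycoord v = 0 by apply/eqP; rewrite -sqrf_eq0 -h x0 mul0r.
  exists (zcoord v), (mkvec 0 1); split; last first.
  - by apply: formP; rewrite /sq !coordE !vecE ?x0 ?y0; ring.
  - exact: mkvec_neq0r (oner_neq0 _).
  - apply: contra_neq v0 => z0.
    by apply: formP; rewrite ?x0 ?y0 ?z0 /xcoord /ycoord /zcoord mxE.
exists (xcoord v)^-1, (mkvec (xcoord v) (ycoord v)); split.
- by rewrite invr_eq0.
- exact: mkvec_neq0l.
- by apply: formP; rewrite /sq !coordE !vecE -?h; field.
Qed.

Lemma memv_pair (x y w : form) :
  reflect (exists a b, w = a *: x + b *: y) (w \in <<[:: x; y]>>%VS).
Proof.
rewrite span_cons span_seq1; apply: (iffP memv_addP).
  by move=> [_ /vlineP[a ->] [_ /vlineP[b ->] ->]]; exists a, b.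
move=> [a [b ->]]; exists (a *: x); first exact/memvZ/memv_line.
by exists (b *: y) => //; exact/memvZ/memv_line.
Qed.

Lemma sq_free u1 u2 : det2 u1 u2 != 0 -> \dim <<[:: sq u1; sq u2]>> = 2%N.
Proof.
move=> d0; suff : free [:: sq u1; sq u2] by rewrite /free => /eqP.
have u20 : sq u2 != 0 by apply: contra_neq (det2_neq0r d0); exact: sq_eq0.
rewrite free_cons seq1_free u20 andbT span_seq1; apply/negP => /vlineP[c h].
have := congr1 (fun v => qf v u2) h; rewrite qfZ !qf_sq /det2.
rewrite [u2 0 0 * _]mulrC subrr expr0n mulr0 => /eqP; rewrite sqrf_eq0.
exact/negP.
Qed.

Lemma chordE (U : {vspace form}) u1 u2 :
  (forall w : form, w \in U <-> exists a b, w = a *: sq u1 + b *: sq u2) ->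
  disc alpha `&` [set scale_class (Kgroup alpha) v | v in [set v | v \in U /\ v != 0]] =
  chord u1 u2.
Proof.
move=> hU; rewrite discE KE; apply/seteqP; split=> x.
  move=> [[w hw <-] [v [vU v0] h]]; have [k ek wE] := cls_eq h.
  have /hU[a [b vE]] := vU; exists (k * a), (k * b).
  have -> : (k * a) *: sq u1 + (k * b) *: sq u2 = w by rewrite wE vE scalerDr !scalerA.
  by [].
move=> [a [b [hv ->]]]; split; first by exists (a *: sq u1 + b *: sq u2).
exists (a *: sq u1 + b *: sq u2) => //; split; first by apply/hU; exists a, b.
exact: even_form_neq0v.
Qed.

(** From an isotropic vector [v] of the plane and a point [s] of the disc, one
    gets a second isotropic vector [s + l0 v], because the polar form does not
    vanish on [(s, v)]. *)
Lemma long_lineE :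
  long_line alpha = [set l | exists u1 u2, det2 u1 u2 != 0 /\ l = chord u1 u2].
Proof.
apply/seteqP; split=> l.
  move=> [[x lx] [U [dimU [v [vU v0 Qv] lE]]]].
  have [s hs sU] : exists2 s : form, even_form s & s \in U.
    move: lx; rewrite lE discE KE => -[[w hw <-] [s [sU s0] h]].
    have [k ek wE] := cls_eq h; exists w => //; by rewrite wE; exact: memvZ.
  have [c1 [u1 [c10 u10 vE]]] := isotropicP v0 Qv.
  have sq1 : sq u1 \in U.
    by have := memvZ c1^-1 vU; rewrite vE scalerA mulVf // scale1r.
  have q0 := even_form_neq0 hs u10; have Qs := ev_neq0 (even_form_Qform hs).1.
  pose l0 := - (Qform s / qf s u1).
  have sE : s = (s + l0 *: sq u1) + (- l0) *: sq u1 by rewrite [(- l0) *: _]scaleNr addrK.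
  have [||c2 [u2 [c20 u20 wE]]] := @isotropicP (s + l0 *: sq u1) _ _.
  - apply: contra_neq Qs => h; rewrite sE h add0r QformZ Qform_sq mulr0 //.
  - by rewrite Qform_comb_sq /l0 mulNr divfK // subrr.
  have sq2 : sq u2 \in U.
    have -> : sq u2 = c2^-1 *: (s + l0 *: sq u1) by rewrite wE scalerA mulVf // scale1r.
    by apply: memvZ; apply: memvD => //; exact: memvZ.
  have d0 : det2 u1 u2 != 0.
    apply: contra_neq Qs => /(det2_eq0 u10)[c u2E].
    by rewrite sE wE u2E sqZ !scalerA -scalerDl QformZ Qform_sq mulr0.
  exists u1, u2; split => //; rewrite lE; apply: chordE => w.
  have -> : U = <<[:: sq u1; sq u2]>>%VS.
    apply/esym/eqP; rewrite eqEdim dimU sq_free // leqnn andbT.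
    by apply/span_subvP => y; rewrite !inE => /orP[]/eqP ->.
  by split=> /memv_pair.
move=> [u1 [u2 [d0 ->]]]; have [a [b [hv _]]] := diagonal_form d0; split.
  by exists (cls (a *: sq u1 + b *: sq u2)), a, b.
exists <<[:: sq u1; sq u2]>>%VS; split; first exact: sq_free.
  exists (sq u1); split; last exact: Qform_sq.
    by apply: memv_span; rewrite inE eqxx.
  by apply: contra_neq (det2_neq0l d0); exact: sq_eq0.
by apply/esym/chordE => w; split=> /memv_pair.
Qed.

(** Otherwise the lattice spanned by [y w1] and [w2], for [y] large, is not
    spanned by multiples of [u1] and [u2]: it contains [y w1] but not the
    projection of this vector onto the line of [u1]. *)
Lemma geo_end u1 u2 w1 w2 : det2 u1 u2 != 0 -> det2 w1 w2 != 0 ->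
  geo u1 u2 = geo w1 w2 -> det2 u1 w1 = 0 \/ det2 u2 w1 = 0.
Proof.
move=> d0 dw h; apply: contrapT => /not_orP[/eqP n1 /eqP n2].
have [a [b w1E]] := basis2 w1 d0.
have a0 : a != 0.
  apply: contra_neq n2 => a0; rewrite w1E a0 scale0r add0r det2Zr /det2; ring.
have [l [m u1E]] := basis2 (a *: u1) dw.
have m0 : m != 0.
  apply: contra_neq n1 => m0; apply: (mulfI a0).
  rewrite mulr0 -det2Zl u1E m0 scale0r addr0 det2Zl /det2; ring.
have ym0 : (p%:R * m)^-1 != 0 by rewrite invr_eq0 mulf_neq0 // p_neq0.
(* With this [y], the coefficient [y m] of [w2] found below is the inverse of
   [p], which is not an integer. *)
set y := (p%:R * m)^-1 in ym0.
have : geo w1 w2 (homothety_class (Zp_span (y *: w1) (1 *: w2))).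
  by exists y => //; exists 1 => //; exact: oner_neq0.
rewrite -h scale1r => -[x x0 [z z0 /class_eq[c c0 E]]].
rewrite dilate_span !scalerA in E; set x' := c * x in E; set z' := c * z in E.
have x'0 : x' != 0 by exact: mulf_neq0.
have z'0 : z' != 0 by exact: mulf_neq0.
have dxz : det2 (x' *: u1) (z' *: u2) != 0 by rewrite det2Zl det2Zr !mulf_neq0.
have dyw : det2 (y *: w1) w2 != 0 by rewrite det2Zl mulf_neq0.
have : Zp_span (y *: w1) w2 (y *: w1) by exact: Zp_spanl.
rewrite E {1}w1E.
have -> : y *: (a *: u1 + b *: u2) = (y * a / x') *: (x' *: u1) + (y * b / z') *: (z' *: u2).
  by rewrite !scalerA !divfK // scalerDr !scalerA.
move=> /(Zp_spanP _ _ dxz)[hya _].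
have : Zp_span (y *: w1) w2 ((y * a / x') *: (x' *: u1)).
  by rewrite E; apply: Zp_spanZ => //; exact: Zp_spanl.
have -> : (y * a / x') *: (x' *: u1) = l *: (y *: w1) + (y * m) *: w2.
  by rewrite scalerA divfK // -scalerA u1E scalerDr !scalerA [y * l]mulrC.
move=> /(Zp_spanP _ _ dyw)[_]; rewrite ZpE /y invfM divfK // absV abs_p invrK.
by rewrite leNgt P_gt1.
Qed.

Lemma geoC u1 u2 : geo u1 u2 = geo u2 u1.
Proof.
apply/seteqP; split=> X [x x0 [y y0 <-]];
  by exists y => //; exists x => //; rewrite Zp_span_swap.
Qed.

Lemma chordC u1 u2 : chord u1 u2 = chord u2 u1.
Proof.
by apply/seteqP; split=> x [a [b h]]; exists b, a; rewrite addrC.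
Qed.

Lemma chord_scale c d u1 u2 : c != 0 -> d != 0 -> chord (c *: u1) (d *: u2) = chord u1 u2.
Proof.
move=> c0 d0; have c2 : c ^+ 2 != 0 by rewrite sqrf_eq0.
have d2 : d ^+ 2 != 0 by rewrite sqrf_eq0.
apply/seteqP; split=> x [a [b]]; rewrite ?sqZ ?scalerA => h.
  by exists (a * c ^+ 2), (b * d ^+ 2).
by exists (a / c ^+ 2), (b / d ^+ 2); rewrite !sqZ !scalerA !divfK.
Qed.

Lemma chord_eq u1 u2 w1 w2 : det2 u1 u2 != 0 -> det2 w1 w2 != 0 ->
  det2 u1 w1 = 0 -> det2 u2 w2 = 0 -> chord u1 u2 = chord w1 w2.
Proof.
move=> d0 dw h1 h2.
have [c w1E] := det2_eq0 (det2_neq0l d0) h1.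
have [d w2E] := det2_eq0 (det2_neq0r d0) h2.
rewrite w1E w2E chord_scale //; apply: contra_neq dw => z0.
  by rewrite w1E z0 scale0r /det2 !mxE !mul0r subrr.
by rewrite w2E z0 scale0r /det2 !mxE !mulr0 subrr.
Qed.

Lemma det2_trans u u1 u2 : u != 0 -> det2 u u1 = 0 -> det2 u u2 = 0 -> det2 u1 u2 = 0.
Proof.
move=> u0 /(det2_eq0 u0)[a ->] /(det2_eq0 u0)[b ->]; rewrite /det2 !mxE; ring.
Qed.

Lemma geo_inj u1 u2 w1 w2 : det2 u1 u2 != 0 -> det2 w1 w2 != 0 ->
  geo u1 u2 = geo w1 w2 -> chord u1 u2 = chord w1 w2.
Proof.
move=> d0 dw h.
have h' : geo u1 u2 = geo w2 w1 by rewrite h geoC.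
have dw' : det2 w2 w1 != 0 by rewrite det2_neq0C.
have [u10 u20] := (det2_neq0l d0, det2_neq0r d0).
have [a1|a2] := geo_end d0 dw h; have [b1|b2] := geo_end d0 dw' h'.
- by move: dw; rewrite (det2_trans u10 a1 b1) eqxx.
- exact: chord_eq.
- by rewrite [RHS]chordC; exact: chord_eq.
- by move: dw; rewrite (det2_trans u20 a2 b2) eqxx.
Qed.

End Padic.

Theorem theorem5p1 (R : realType) (p : nat) (K : padicField R p)
    (mu : {measure set (kstar_borel K) -> \bar R}) (alpha : K)
    (p_prime : prime p) (p_odd : odd p)
    (mu_haar : is_normalized_haar mu)
    (alpha_neq0 : alpha != 0) (alpha_even : even_valuation alpha)
    (alphaN1 : ~ square_class alpha (-1)) :
  (forall v, disc alpha v -> exists! w,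
     tree K w /\
     stabilizer (disc_act K) v `<=` stabilizer (tree_act K) w) /\
  (forall pi : set 'rV[K]_3 -> set (set 'cV[K]_2),
     (forall v, disc alpha v -> tree K (pi v) /\
        stabilizer (disc_act K) v `<=` stabilizer (tree_act K) (pi v)) ->
     [/\ quasi_isometry (disc alpha) (tree K)
           (hilbert_dist alpha mu) (tree_dist K) pi,
         (forall G v, PGL2 G -> disc alpha v ->
            pi (disc_act K G v) = tree_act K G (pi v)) &
         set_bij (long_line alpha) (geodesic K) (fun l => pi @` l)]).
Proof.
have alpha_ns := nonsquare_opp alpha_neq0 alphaN1.
have KE := Kgroup_evE p_prime p_odd alpha_even alpha_ns.
have [c c0 delta1] := ev_normalize p_prime alpha_even.
have delta_ns : ~ is_square (- (c ^+ 2 * alpha)).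
  by rewrite -mulrN => /(is_square_mulr_sq c0).
have dE := discE p_prime KE.
split.
  move=> v; rewrite dE => -[w hw <-]; exists (proj w); split.
    by split; [exact: proj_tree|exact: stabilizer_proj].
  by move=> X [tX hX]; apply/esym; exact: (stabilizer_unique p_prime).
move=> pi hpi.
have piE v : even_form v -> pi (scale_class (@even_valuation R p K) v) = proj v.
  move=> hv; have [|tX hX] := hpi (scale_class (@even_valuation R p K) v).
    by rewrite dE; exists v.
  exact: (stabilizer_unique p_prime).
split.
(* The constants come from [n <= d <= 2 n + 1], for [n] the distance in the tree
   and [d] the Hilbert distance. *)
- exists 2, 1; split => //; first by rewrite ler1n.
    move=> x x'; rewrite dE => -[v hv <-] [w hw <-].
    have [w' [e1 [e2 [n [hw' <- d0 [bv bw]]]]]] := adapted_forms p_prime p_odd hv hw.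
    rewrite !piE //; exact: (dist_comparison p_prime p_odd KE mu_haar hv hw' d0 bv bw).
  move=> X tX; have [v hv ->] := proj_surj p_prime p_odd delta1 delta_ns tX.
  exists (scale_class (@even_valuation R p K) v); first by rewrite dE; exists v.
  have [w [e1 [e2 [n [hw _ d0 [bv _]]]]]] := adapted_forms p_prime p_odd hv hv.
  by rewrite piE // /proj bv -{2}[e2]scale1r -(expr0 p%:R) tree_dist_span.
- move=> G v PG dv; have [g gu GE] := PG; move: dv; rewrite dE GE => -[w hw <-].
  rewrite disc_act_cls // !piE //; last exact: even_form_gact.
  by rewrite proj_gact.
- have img u1 u2 : det2 u1 u2 != 0 -> pi @` chord u1 u2 = geo u1 u2.
    by move=> d0; exact: (chord_image p_prime p_odd delta1 delta_ns d0 piE).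
  rewrite (long_lineE p_prime p_odd KE delta1 delta_ns) geodesicE.
  split.
  + by move=> l [u1 [u2 [d0 ->]]]; exists u1, u2; split => //; exact: img.
  + move=> l l' /set_mem[u1 [u2 [d0 ->]]] /set_mem[w1 [w2 [dw ->]]].
    by rewrite !img //; exact: (geo_inj p_prime).
  + by move=> _ [u1 [u2 [d0 ->]]]; exists (chord u1 u2); [exists u1, u2|exact: img].
Qed.
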